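(* Let $R=(R_{ij})$ be a real symmetric $d\times d$ matrix with $R_{ij}\ge 0$ for all $i,j$ and $\sum_i R_{ij}>0$ for each $j$, and let $V(n)$, $n\ge d$, be the normalized occupation vectors of the vertex-reinforced random walk with matrix $R$. Suppose that $R$ is nonsingular, and let $p$ be the unique critical point in the interior of the simplex $\triangle$ (assumed to exist; i.e. $\pi(p)=p$ and $p_i>0$ for all $i$). Then $\mathbf P(V(n)\to p)=0$ whenever $p$ fails to be a maximum for $H$ on $\triangle$. Moreover, the following are equivalent: (a) $p$ fails to be a maximum for $H$ on $\triangle$; (b) $R$ has more than one positive eigenvalue (counted with multiplicity); (c) the linear operator $D_p(\pi-I)$ on the tangent space $W=\{w\in\mathbb R^d:\sum_i w_i=0\}$ of $\triangle$ has a positive eigenvalue.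
   Context: Vertex-reinforced random walk with matrix $R$: define random variables $Y_n\in\{1,\dots,d\}$ and $S(n)=(S_1(n),\dots,S_d(n))$ for $n\ge d$ inductively. Set $S_i(d)=1$ for all $i$ and $Y_d=1$. Let $\mathcal F_n$ be the $\sigma$-field generated by $Y_d,\dots,Y_n$. Then $$\mathbf P(Y_{n+1}=j\mid\mathcal F_n)=\frac{R_{Y_n,j}\,S_j(n)}{\sum_i R_{Y_n,i}\,S_i(n)},$$ and $S_i(n+1)=S_i(n)+\mathbf 1_{\{Y_{n+1}=i\}}$. Put $V(n)=S(n)/n$, an element of the simplex $\triangle=\{v\in\mathbb R^d: v_i\ge 0,\ \sum_i v_i=1\}$. For $v\in\triangle$ let $N_i(v)=\sum_j R_{ij}v_j$ and $H(v)=\sum_i v_iN_i(v)=\sum_{i,j}R_{ij}v_iv_j$. For $v\in\triangle$ with $H(v)>0$ let $\pi(v)\in\triangle$ be given by $\pi_i(v)=v_iN_i(v)/H(v)$. A critical point is a $v\in\triangle$ with $H(v)>0$ and $\pi(v)=v$. $D_p(\pi-I)$ denotes the derivative at $p$ of the map $v\mapsto\pi(v)-v$; since $\pi$ maps $\triangle$ to $\triangle$, it restricts to a linear operator on $W$. *)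

(* Defs.v *)
From HB Require Import structures.
From mathcomp Require Import all_boot all_order all_algebra.
From mathcomp Require Import polyrcf.
From mathcomp Require Import all_classical all_reals all_analysis.
Import numFieldNormedType.Exports.
Set Implicit Arguments.
Unset Strict Implicit.
Unset Printing Implicit Defensive.
Import Order.TTheory GRing.Theory Num.Theory.
Local Open Scope classical_set_scope.
Local Open Scope ring_scope.

Section Simplex.
Context {K : realType} {d : nat}.
Implicit Types (R : 'M[K]_d) (v w p : 'rV[K]_d).

Definition simplex : set 'rV[K]_d :=
  [set v | (forall i, 0 <= v 0 i) /\ \sum_i v 0 i = 1].

Definition tangent : set 'rV[K]_d := [set w | \sum_i w 0 i = 0].

Definition Nfun R v (i : 'I_d) : K := \sum_j R i j * v 0 j.

Definition Hfun R v : K := \sum_i v 0 i * Nfun R v i.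

(* The defining formula makes sense on the whole of R^d (division is total),
   so its derivative at a point with [Hfun R p > 0] is the usual Frechet
   derivative; only values at points with [Hfun R v > 0] are meaningful. *)
Definition pimap R v : 'rV[K]_d := \row_i (v 0 i * Nfun R v i / Hfun R v).

Definition critical R v : Prop :=
  [/\ simplex v, 0 < Hfun R v & pimap R v = v].

Definition is_simplex_max (f : 'rV[K]_d -> K) p : Prop :=
  simplex p /\ forall v, simplex v -> f v <= f p.

(* [rootsR] lists each distinct real root once; multiplicities are the
   algebraic ones. *)
Definition num_pos_eigenvalues (A : 'M[K]_d) : nat :=
  (\sum_(a <- rootsR (char_poly A) | (0 < a)%R) mup a (char_poly A))%N.

Definition pi_derivative R p : 'rV[K]_d -> 'rV[K]_d :=
  'd (fun v : 'rV[K]_d => pimap R v - v) p.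

Definition tangent_eigenvalue (L : 'rV[K]_d -> 'rV[K]_d) (a : K) : Prop :=
  exists w, [/\ tangent w, w != 0 & L w = a *: w].

End Simplex.

Section VRRW.
Context {K : realType} {disp : measure_display} {T : measurableType disp}.
Variable P : probability T K.

(* [g] is a version of the conditional probability of [A] given the
   sub-sigma-algebra [G]. *)
Record is_cond_prob (G : set (set T)) (A : set T) (g : T -> K) : Prop :=
  IsCondProb {
  cond_prob_measurable :
    forall B : set K, measurable B -> G (g @^-1` B) ;
  cond_prob_integrable : P.-integrable setT (EFin \o g) ;
  cond_prob_integral :
    forall B, G B -> (\int[P]_(x in B) (g x)%:E = P (A `&` B))%E }.

Context {d : nat}.
Variables (Y : nat -> T -> 'I_d) (S : nat -> T -> 'rV[K]_d).

Definition natural_filtration (n : nat) : set (set T) :=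
  <<s [set A | exists k i, (d <= k <= n)%N /\ A = [set x | Y k x = i]] >>.

(* States are numbered from 0, so the initial state 1 is [Ordinal d_gt0].
   Time starts at [d]; the values of [Y n] and [S n] for [n < d] are not
   constrained. *)
Record is_VRRW (R : 'M[K]_d) (d_gt0 : (0 < d)%N) : Prop := IsVRRW {
  VRRW_measurable :
    forall n i, (d <= n)%N -> measurable [set x | Y n x = i] ;
  VRRW_Y_init : forall x, Y d x = Ordinal d_gt0 ;
  VRRW_S_init : forall x i, S d x 0 i = 1 ;
  VRRW_S_step : forall n x i, (d <= n)%N ->
    S n.+1 x 0 i = S n x 0 i + (Y n.+1 x == i)%:R ;
  VRRW_transition : forall n j, (d <= n)%N ->
    is_cond_prob (natural_filtration n) [set x | Y n.+1 x = j]
      (fun x => R (Y n x) j * S n x 0 j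
                / \sum_i R (Y n x) i * S n x 0 i) }.

Definition occupation (n : nat) (x : T) : 'rV[K]_d := n%:R^-1 *: S n x.

End VRRW.

(* Main.v *)
From HB Require Import structures.
Require Import Defs.
From mathcomp Require Import all_boot all_order all_algebra.
From mathcomp Require Import complex polyrcf.
From mathcomp Require Import all_classical all_reals all_analysis.
From mathcomp Require Import ring lra.
Import numFieldNormedType.Exports.
Set Implicit Arguments.
Unset Strict Implicit.
Unset Printing Implicit Defensive.
Import Order.TTheory GRing.Theory Num.Theory.
Local Open Scope classical_set_scope.
Local Open Scope ring_scope.

(** Write h = H(p).  Since p_i > 0, criticality says N_i(p) = h for every i, so
    p is R-orthogonal to the tangent space W, and H(p + w) = h + H(w) for w in W.
    Hence p is a maximum of H on the simplex iff the quadratic form H is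
    nonpositive on W ([not_simplex_maxP]).  As H(p) > 0, the form is positive definite on
    some plane iff it is positive somewhere on W, and by the spectral theorem this
    counts positive eigenvalues ([not_simplex_max_eigenvalues]).  On W the
    derivative of pi - I is A : w |-> (p_i N_i(w) / h)_i, which is self-adjoint
    for the weights 1 / p_i, with quadratic form H / h; so it has a positive
    eigenvalue iff H is positive somewhere on W ([tangent_eigenvalueP]).

    Nonconvergence.  Fix G, a rule that tells which occupation counts are allowed
    at which time and that forces V(n) -> p at a deterministic rate.  By Egorov,
    if V(n) -> p had positive probability, then so would the event that all the
    counts are allowed, for a suitable G.  It is enough to bound, uniformly in
    the state at a late time n, the probability [stay] of being allowed for k
    more steps, k large, by a constant c < 1 ([stay_bound_all]): the event E of
    being always allowed then satisfies P(E) <= c P(D_n) for the events D_n that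
    decrease to E, so P(E) <= c P(E) ([good_null]).

    For the bound, run two independent copies of the walk from the same state at
    time n0 and look at the difference of their occupation vectors.  Comparing two
    copies, instead of one copy with p, makes all error terms proportional to the
    difference itself, so that no stable manifold has to be straightened.  The
    steps form a Markov chain with kernel K_v(i,j) = R_ij v_j / N_i(v) that depends
    slowly on v; adding the solution of the Poisson equation of K_v to the counts
    ([corrector]) gives a process whose mean increment is pi(v) up to O(1/n).  Let
    x be the corrected difference divided by n.  For an unstable direction with
    weights th, take the quadratic form B(x) = H(x) + M (th . x)^2.  The drift of
    B(x) is at least c |x|^2 / n because R is invertible ([drift_coercive]), and
    for M large the noise, being non-degenerate along th, adds at least c / n^2
    ([noise_var_gt0]).  After small corrections the resulting function [lyapunov]
    has a drift that dominates the squares of its increments.  Therefore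
    exp(- kap n0 lyapunov) is a supermartingale for a small constant kap
    ([exp_mean_le1]).  It starts below a constant smaller than 1, and it tends to 1
    if both copies converge to p; so the square of [stay] is bounded by a constant
    smaller than 1 ([stay_bound]).  The Poisson equation needs the chain K_p to be
    irreducible; otherwise the walk never leaves a proper subset of the vertices, and
    some coordinate of V(n) tends to 0. *)

(** * Counting the positive eigenvalues of a symmetric matrix *)

Section Spectral.
Variables (K : realType) (d : nat).
Implicit Types (A : 'M[K]_d) (u v w p : 'rV[K]_d) (z : 'rV[K[i]]_d).

Local Notation toC := (real_complex K).
Local Notation "M ^t*" := (map_mx (@Num.conj K[i]) (M^T)) (at level 30).
Local Notation re := (@complex.Re K).
Local Notation im := (@complex.Im K).
Definition sqmod (c : K[i]) : K := re c ^+ 2 + im c ^+ 2.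

Lemma sqmodE (c : K[i]) : toC (sqmod c) = c * Num.conj c.
Proof. by rewrite /sqmod add_Re2_Im2 normCK. Qed.

Lemma sqmod_ge0 c : 0 <= sqmod c.
Proof. by rewrite addr_ge0 ?sqr_ge0. Qed.

Lemma sqmod_eq0 c : (sqmod c == 0) = (c == 0).
Proof.
by rewrite paddr_eq0 ?sqr_ge0// !sqrf_eq0 eq_complex.
Qed.

(** The eigenvectors are taken over K[i], where every Hermitian matrix has an
    orthonormal eigenbasis; the eigenvalues are real. *)
Lemma real_sym_spectral A : A^T = A -> exists (x : 'rV[K]_d) (P : 'M[K[i]]_d),
  [/\ P *m P ^t* = 1%:M, P ^t* *m P = 1%:M &
      map_mx toC A = P ^t* *m diag_mx (map_mx toC x) *m P].
Proof.
move=> A_sym; set B := map_mx toC A.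
have B_herm : B \is hermitianmx _ false (@Num.conj K[i]).
  apply: realsym_hermsym.
    by apply/is_hermitianmxP; rewrite expr0 scale1r map_mx_id// /B map_trmx A_sym.
  by apply/mxOverP => i j; rewrite mxE; apply/complex_realP; exists (A i j).
have /orthomx_spectralP B_eq := hermitian_normalmx B_herm.
have /mxOverP x_real := hermitian_spectral_diag_real B_herm.
have P_unit := spectral_unitarymx B.
exists (map_mx re (spectral_diag B)), (spectralmx B).
have -> : map_mx toC (map_mx re (spectral_diag B)) = spectral_diag B.
  by apply/matrixP => i j; rewrite !mxE RRe_real// x_real.
rewrite -invmx_unitary// mulmxV ?mulVmx ?unitarymx_unit//.
Qed.

Lemma char_poly_spectral A (x : 'rV[K]_d) (P : 'M[K[i]]_d) :
  P *m P ^t* = 1%:M -> map_mx toC A = P ^t* *m diag_mx (map_mx toC x) *m P ->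
  char_poly A = \prod_i ('X - (x 0 i)%:P).
Proof.
move=> PP A_eq; apply: (map_poly_inj toC).
rewrite map_char_poly A_eq.
have P_unit : P \in unitmx by case: (mulmx1_unit PP).
have -> : P ^t* = invmx P.
  by rewrite -[LHS]mul1mx -(mulVmx P_unit) -mulmxA PP mulmx1.
rewrite /char_poly /char_poly_mx.
have -> : 'X%:M - map_mx polyC (invmx P *m diag_mx (map_mx toC x) *m P) =
   map_mx polyC (invmx P) *m ('X%:M - map_mx polyC (diag_mx (map_mx toC x)))
    *m map_mx polyC P.
  rewrite mulmxBr mulmxBl !map_mxM; congr (_ - _).
  by rewrite scalar_mxC -mulmxA -map_mxM mulVmx// map_mx1 mulmx1.
rewrite !det_mulmx mulrAC -det_mulmx -map_mxM mulVmx// map_mx1 det1 mul1r.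
have -> : 'X%:M - map_mx polyC (diag_mx (map_mx toC x)) =
   diag_mx (\row_i ('X - (toC (x 0 i))%:P)).
  apply/matrixP => i j; rewrite !mxE.
  by case: eqP => [->|_]; rewrite ?mulr1n// !mulr0n polyC0 subr0.
rewrite det_diag rmorph_prod /=; apply: eq_bigr => i _.
by rewrite !mxE rmorphB /= map_polyX map_polyC.
Qed.

Lemma num_pos_eigenvalues_spectral A (x : 'rV[K]_d) :
  char_poly A = \prod_i ('X - (x 0 i)%:P) ->
  num_pos_eigenvalues A = #|[pred i | 0 < x 0 i]|.
Proof.
move=> cpE; rewrite /num_pos_eigenvalues cpE.
set s := [seq x 0 i | i <- enum 'I_d].
have -> : \prod_i ('X - (x 0 i)%:P) = \prod_(a <- s) ('X - a%:P).
  by rewrite big_map big_enum.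
under eq_bigr => a _ do rewrite mu_prod_XsubC.
have q_neq0 : \prod_(a <- s) ('X - a%:P) != 0.
  by rewrite monic_neq0// monic_prod_XsubC.
have r_uniq : uniq (rootsR (\prod_(a <- s) ('X - a%:P))).
  exact/(sorted_uniq lt_trans)/sorted_roots/ltxx.
have mem_r a : (a \in rootsR (\prod_(a <- s) ('X - a%:P))) = (a \in s).
  by rewrite -(roots_on_rootsR q_neq0 a) root_prod_XsubC in_itv.
rewrite cardE /enum_mem size_filter -enumT.
transitivity (count (fun a => 0 < a) s); last first.
  by rewrite count_map; apply: eq_count.
move: (rootsR _) r_uniq mem_r => r r_uniq mem_r.
rewrite -big_filter -sum1_count -[RHS]big_filter.
under eq_bigr => a _ do rewrite -sum1_count.
rewrite (exchange_big_dep predT)//=.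
rewrite [RHS]big_filter [RHS]big_mkcond.
apply: eq_big_seq => a a_s.
rewrite big_filter_cond; rewrite sum1_count.
case: ifP => a_gt0.
  rewrite (@eq_count _ _ (pred1 a)) ?count_uniq_mem ?mem_r ?a_s//.
  by move=> b /=; rewrite (eq_sym b); case: eqP => [<-|]; rewrite ?a_gt0 ?andbF.
rewrite (@eq_count _ _ pred0) ?count_pred0//.
by move=> b /=; case: eqP => [<-|]; rewrite ?andbF// a_gt0.
Qed.

(** As A is real, the Hermitian form at z is the sum of the quadratic forms at the
    real and imaginary parts of z; so a sign of the Hermitian form at a complex
    vector is a sign of the quadratic form at a real one. *)
Lemma quad_spectral A (x : 'rV[K]_d) (P : 'M[K[i]]_d) z :
  map_mx toC A = P ^t* *m diag_mx (map_mx toC x) *m P ->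
  Hfun A (map_mx re z) + Hfun A (map_mx im z) =
  \sum_k x 0 k * sqmod ((z *m P ^t*) 0 k).
Proof.
move=> A_eq.
have E : (z *m map_mx toC A *m z ^t*) 0 0 =
         toC (\sum_k x 0 k * sqmod ((z *m P ^t*) 0 k)).
  have -> : z *m map_mx toC A *m z ^t* = z *m P ^t* *m diag_mx (map_mx toC x)
     *m (z *m P ^t*) ^t*.
    have -> : (z *m P ^t*) ^t* = P *m z ^t*.
      rewrite trmx_mul map_mxM -!map_trmx trmxK -map_mx_comp.
      by rewrite (map_mx_id (@conjCK _)).
    by rewrite A_eq !mulmxA.
  rewrite mxE rmorph_sum /=; apply: eq_bigr => k _.
  rewrite rmorphM /= sqmodE mul_mx_diag !mxE mulrAC; ring.
have := congr1 re E; rewrite /= => <-.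
rewrite mxE raddf_sum /= /Hfun /Nfun -big_split /=.
under [RHS]eq_bigr => j _ do rewrite !mxE mulr_suml raddf_sum /=.
rewrite [RHS]exchange_big /=; apply: eq_bigr => i _.
rewrite !mulr_sumr -big_split /=; apply: eq_bigr => j _.
rewrite !mxE; case: (z 0 i) (z 0 j) => [a b] [c e] /=.
ring.
Qed.

End Spectral.

Section PositiveEigenvalues.
Variables (K : realType) (d : nat).
Implicit Types (A : 'M[K]_d) (u v w p : 'rV[K]_d) (z : 'rV[K[i]]_d).
Local Notation toC := (real_complex K).
Local Notation re := (@complex.Re K).
Local Notation im := (@complex.Im K).
Local Notation "M ^t*" := (map_mx (@Num.conj K[i]) (M^T)) (at level 30).

Lemma quad_spectral_real A (x : 'rV[K]_d) (P : 'M[K[i]]_d) u :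
  map_mx toC A = P ^t* *m diag_mx (map_mx toC x) *m P ->
  Hfun A u = \sum_k x 0 k * sqmod ((map_mx toC u *m P ^t*) 0 k).
Proof.
move=> A_eq; rewrite -(quad_spectral _ A_eq).
have -> : map_mx re (map_mx toC u) = u by apply/matrixP => i j; rewrite !mxE.
have -> : map_mx im (map_mx toC u) = 0 by apply/matrixP => i j; rewrite !mxE.
rewrite [X in _ + X]big1 ?addr0// => i _; rewrite mxE mul0r//.
Qed.

Lemma quad_spectral_coef A (x : 'rV[K]_d) (P : 'M[K[i]]_d) (c : 'rV[K[i]]_d) :
  P *m P ^t* = 1%:M ->
  map_mx toC A = P ^t* *m diag_mx (map_mx toC x) *m P ->
  Hfun A (map_mx re (c *m P)) + Hfun A (map_mx im (c *m P)) =
    \sum_k x 0 k * sqmod (c 0 k).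
Proof.
by move=> PP A_eq; rewrite (quad_spectral _ A_eq) -mulmxA PP mulmx1.
Qed.

Lemma re_mulCl (a : K) c : re (toC a * c) = a * re c.
Proof. by case: c => b e /=; rewrite mul0r subr0. Qed.

Lemma im_mulCl (a : K) c : im (toC a * c) = a * im c.
Proof. by case: c => b e /=; rewrite mul0r addr0. Qed.

(** If no eigenvalue were positive, the form would be nonpositive.  The real or the
    imaginary part of a complex eigenvector is a real one. *)
Lemma sym_pos_eigenvector A u : A^T = A -> 0 < Hfun A u ->
  exists2 a : K, 0 < a & exists2 w : 'rV[K]_d, w != 0 & w *m A = a *: w.
Proof.
move=> A_sym u_pos; have [x [P [PP P'P A_eq]]] := real_sym_spectral A_sym.
have [k x_gt0] : exists k, 0 < x 0 k.
  apply: contrapT => /forallNP x_le0; move: u_pos; apply/negP; rewrite -leNgt.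
  rewrite (quad_spectral_real _ A_eq) sumr_le0// => k _.
  by rewrite mulr_le0_ge0 ?sqmod_ge0// leNgt; apply/negP.
exists (x 0 k) => //; set z := row k P.
have zA : z *m map_mx toC A = toC (x 0 k) *: z.
  rewrite A_eq !mulmxA /z -row_mul PP -row_mul mul1mx row_diag_mx mxE.
  by rewrite -scalemxAl -rowE.
have z_neq0 : z != 0.
  apply/eqP => z0; have /rowP/(_ k) := congr1 (row k) PP.
  rewrite row_mul -/z z0 mul0mx !mxE eqxx => /eqP.
  by rewrite eq_sym oner_eq0.
have re_eig : map_mx re z *m A = x 0 k *: map_mx re z.
  apply/rowP => j; have /rowP/(_ j) /(congr1 re) := zA.
  rewrite !mxE raddf_sum re_mulCl => <-.
  by apply: eq_bigr => i _; rewrite !mxE mulrC -re_mulCl mulrC.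
have im_eig : map_mx im z *m A = x 0 k *: map_mx im z.
  apply/rowP => j; have /rowP/(_ j) /(congr1 im) := zA.
  rewrite !mxE raddf_sum im_mulCl => <-.
  by apply: eq_bigr => i _; rewrite !mxE mulrC -im_mulCl mulrC.
have [re0|?] := eqVneq (map_mx re z) 0; last by exists (map_mx re z).
exists (map_mx im z) => //; apply: contra_neq z_neq0 => im0.
apply/rowP => j; have /rowP/(_ j) := re0; have /rowP/(_ j) := im0.
by rewrite !mxE => i0 r0; apply/eqP; rewrite eq_complex i0 r0 !eqxx.
Qed.

(** The complex plane spanned by two eigenvectors with positive eigenvalues meets
    the hyperplane of vectors with coordinate sum 0. *)
Lemma two_pos_eigenvalues_tangent A : A^T = A ->
  (1 < num_pos_eigenvalues A)%N -> exists2 w, tangent w & 0 < Hfun A w.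
Proof.
move=> A_sym; have [x [P [PP P'P A_eq]]] := real_sym_spectral A_sym.
rewrite (num_pos_eigenvalues_spectral (char_poly_spectral PP A_eq)).
move=> /card_gt1P [k [l [xk xl kl]]]; rewrite !inE in xk xl.
have lk : l != k by rewrite eq_sym.
suff [c c_sum [i c_i c_supp]] : exists2 c : 'rV[K[i]]_d,
    \sum_j (c *m P) 0 j = 0 & exists2 i, c 0 i != 0 & forall m, c 0 m != 0 -> 0 < x 0 m.
  have : 0 < Hfun A (map_mx re (c *m P)) + Hfun A (map_mx im (c *m P)).
    rewrite (quad_spectral_coef _ PP A_eq) (bigD1 i)//=.
    rewrite ltr_pwDl ?mulr_gt0 ?c_supp ?sumr_ge0//.
      by rewrite lt_def sqmod_ge0 sqmod_eq0 c_i.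
    move=> m _; have [->|/c_supp/ltW xm] := eqVneq (c 0 m) 0.
      by rewrite /sqmod /= expr0n addr0 mulr0.
    by rewrite mulr_ge0// sqmod_ge0.
  have sum0 : tangent (map_mx re (c *m P)) /\ tangent (map_mx im (c *m P)).
    split; rewrite /tangent /=; [have := congr1 re c_sum|have := congr1 im c_sum];
      rewrite raddf_sum /= => {2}<-; by under eq_bigr => j _ do rewrite mxE.
  have [re_pos|re_neg] := ltP 0 (Hfun A (map_mx re (c *m P))).
    by move=> _; exists (map_mx re (c *m P)) => //; case: sum0.
  move=> H; exists (map_mx im (c *m P)); first by case: sum0.
  by move: H re_neg; lra.
pose s m := \sum_j P m j.
have sumE c : \sum_j (c *m P) 0 j = \sum_m c 0 m * s m.
  under eq_bigr do rewrite mxE; rewrite exchange_big /=.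
  by apply: eq_bigr => m _; rewrite mulr_sumr.
have [sk0|sk] := eqVneq (s k) 0.
  exists (delta_mx 0 k).
    rewrite sumE (bigD1 k)//= sk0 mulr0 add0r big1// => m mk.
    by rewrite mxE eqxx (negbTE mk) mul0r.
  exists k => [|m]; rewrite mxE ?eqxx ?oner_eq0//.
  by case: (eqVneq m k) => [->//|_]; rewrite ?andbF eqxx.
exists (s l *: delta_mx 0 k - s k *: delta_mx 0 l).
  rewrite sumE (bigD1 k)//= (bigD1 l)//= big1 => [|m /andP[mk ml]].
    by rewrite !mxE !eqxx (negbTE kl) (negbTE lk) /=; ring.
  by rewrite !mxE (negbTE mk) (negbTE ml) andbF !mulr0 subr0 mul0r.
exists l.
  by rewrite !mxE !eqxx (negbTE lk) mulr0 sub0r mulr1 oppr_eq0.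
move=> m; rewrite !mxE; case: (eqVneq m k) => [->//|_].
case: (eqVneq m l) => [->//|_]; by rewrite ?andbF !mulr0 subr0 eqxx.
Qed.

Lemma NfunD A u v i : Nfun A (u + v) i = Nfun A u i + Nfun A v i.
Proof.
by rewrite /Nfun -big_split /=; apply: eq_bigr => j _; rewrite mxE mulrDr.
Qed.

Lemma NfunZ A c u i : Nfun A (c *: u) i = c * Nfun A u i.
Proof. by rewrite /Nfun mulr_sumr; apply: eq_bigr => j _; rewrite mxE mulrCA. Qed.

Lemma HfunZ A c u : Hfun A (c *: u) = c ^+ 2 * Hfun A u.
Proof.
rewrite /Hfun mulr_sumr; apply: eq_bigr => i _; rewrite mxE NfunZ; ring.
Qed.

Lemma Nfun_sym A u v : A^T = A ->
  \sum_i u 0 i * Nfun A v i = \sum_i v 0 i * Nfun A u i.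
Proof.
move=> A_sym; rewrite /Nfun; under eq_bigr do rewrite mulr_sumr.
rewrite exchange_big; apply: eq_bigr => i _; rewrite mulr_sumr.
by apply: eq_bigr => j _; rewrite -[in LHS]A_sym mxE; ring.
Qed.

Lemma HfunD A u v : A^T = A ->
  Hfun A (u + v) = Hfun A u + Hfun A v + 2 * \sum_i u 0 i * Nfun A v i.
Proof.
move=> A_sym; rewrite /Hfun.
under eq_bigr do rewrite mxE NfunD mulrDl !mulrDr.
by rewrite !big_split /= [X in _ + (X + _)]Nfun_sym//; ring.
Qed.

(** The form is positive definite on the plane of u and w.  With at most one positive
    eigenvalue, the plane would contain a nonzero vector without component along
    that eigenvector, where the form is nonpositive. *)
Lemma two_pos_orthogonal_eigenvalues A u w : A^T = A ->
  0 < Hfun A u -> 0 < Hfun A w -> \sum_i u 0 i * Nfun A w i = 0 ->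
  (1 < num_pos_eigenvalues A)%N.
Proof.
move=> A_sym u_pos w_pos uw0.
have [x [P [PP P'P A_eq]]] := real_sym_spectral A_sym.
rewrite (num_pos_eigenvalues_spectral (char_poly_spectral PP A_eq)).
rewrite ltnNge; apply/negP => card_le1.
have cross r s : Hfun A (r *: u + s *: w) = r ^+ 2 * Hfun A u + s ^+ 2 * Hfun A w.
  rewrite HfunD// !HfunZ -[RHS]addr0; congr (_ + _).
  under eq_bigr do rewrite mxE NfunZ mulrACA.
  by rewrite -mulr_sumr uw0 !mulr0.
have Hpos (a b : K[i]) : a != 0 \/ b != 0 ->
   0 < \sum_k x 0 k * sqmod (((a *: map_mx toC u + b *: map_mx toC w) *m P ^t*) 0 k).
  move=> ab; rewrite -(quad_spectral _ A_eq).
  have -> : Hfun A (map_mx re (a *: map_mx toC u + b *: map_mx toC w)) +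
     Hfun A (map_mx im (a *: map_mx toC u + b *: map_mx toC w)) =
     sqmod a * Hfun A u + sqmod b * Hfun A w.
    have rE : map_mx re (a *: map_mx toC u + b *: map_mx toC w) =
        re a *: u + re b *: w.
      by apply/rowP => i; rewrite !mxE raddfD /= !(mulrC _ (toC _)) !re_mulCl
        ![_ * u 0 i]mulrC ![_ * w 0 i]mulrC.
    have iE : map_mx im (a *: map_mx toC u + b *: map_mx toC w) =
        im a *: u + im b *: w.
      by apply/rowP => i; rewrite !mxE raddfD /= !(mulrC _ (toC _)) !im_mulCl
        ![_ * u 0 i]mulrC ![_ * w 0 i]mulrC.
    rewrite rE iE !cross /sqmod; ring.
  have : 0 < sqmod a \/ 0 < sqmod b.
    by case: ab => ?; [left|right]; rewrite lt_def sqmod_ge0 sqmod_eq0 andbT.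
  have := sqmod_ge0 a; have := sqmod_ge0 b; case=> *; nra.
have [k x_le0] : exists k, forall m, m != k -> x 0 m <= 0.
  have [k xk|nopos] := pickP [pred i | 0 < x 0 i].
    exists k => m mk; rewrite leNgt; apply/negP => xm.
    move: card_le1; rewrite leqNgt => /negP; apply; apply/card_gt1P.
    by exists m, k; split.
  have [k _|no_index] := pickP (@predT 'I_d).
    by exists k => m _; rewrite leNgt -[_ < _]/([pred i | 0 < x 0 i] m) nopos.
  by move: u_pos; rewrite /Hfun big1 ?ltxx// => i; have := no_index i.
pose coef v := (map_mx toC v *m P ^t*) 0 k.
have [a [b [ab abk]]] : exists a b : K[i], (a != 0 \/ b != 0) /\
    a * coef u + b * coef w = 0.
  have [u0|u_neq0] := eqVneq (coef u) 0.
    by exists 1, 0; split; [left; rewrite oner_eq0|rewrite u0 mulr0 mul0r addr0].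
  by exists (coef w), (- coef u); split; [right; rewrite oppr_eq0|ring].
have := Hpos a b ab; apply/negP; rewrite -leNgt; apply: sumr_le0 => m _.
have [->|mk] := eqVneq m k; last by rewrite mulr_le0_ge0 ?sqmod_ge0 ?x_le0.
rewrite mulmxDl -!scalemxAl.
have -> : (a *: (map_mx toC u *m P ^t*) + b *: (map_mx toC w *m P ^t*)) 0 k = 0.
  by rewrite mxE [X in X + _]mxE [X in _ + X]mxE.
by rewrite /sqmod /= expr0n addr0 mulr0.
Qed.
End PositiveEigenvalues.

(** * Local Lipschitz continuity and strict derivatives *)

Section LocalLipschitz.
Variables (K : realType) (V : normedModType K) (p : V).
Implicit Types (f g : V -> K) (l : V -> K).

(** Stated near (p, p) in the product, so that it bounds the difference of the values
    at two points close to p. *)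
Definition loclip f := exists C, \forall x \near (p, p),
  `|f x.1 - f x.2| <= C * `|x.1 - x.2|.

Lemma loclip_cvg f : loclip f -> f x @[x --> p] --> f p.
Proof.
move=> [C fC].
have vp : (v, p) @[v --> p] --> (p, p) by apply: cvg_pair; [exact: cvg_id|exact: cvg_cst].
have fCp : \forall v \near p, `|f v - f p| <= C * `|v - p| by exact: (vp _ fC).
have Cvp : C * `|v - p| @[v --> p] --> 0.
  rewrite -[X in _ --> X](mulr0 C) -(@normr0 _ V) -(subrr p).
  by apply: cvgM; [exact: cvg_cst|apply: cvg_norm; apply: cvgB; [exact: cvg_id|exact: cvg_cst]].
apply/cvgrPdist_le => e e_gt0; near=> v.
rewrite distrC (le_trans (near fCp v _))//.
apply: (le_trans (ler_norm _)); rewrite -[leLHS]normrN -[X in `|X|]sub0r.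
by near: v; move/cvgrPdist_le : Cvp => /(_ e e_gt0).
Unshelve. all: by end_near. Qed.

Lemma loclip_cvg1 f : loclip f -> f x.1 @[x --> (p, p)] --> f p.
Proof. by move=> /loclip_cvg fp; apply: (cvg_comp _ _ cvg_fst fp). Qed.

Lemma loclip_cvg2 f : loclip f -> f x.2 @[x --> (p, p)] --> f p.
Proof. by move=> /loclip_cvg fp; apply: (cvg_comp _ _ cvg_snd fp). Qed.

Lemma cvg_bounded_near (h : V * V -> K) a : h x @[x --> (p, p)] --> a ->
  \forall x \near (p, p), `|h x| <= `|a| + 1.
Proof.
move=> ha; near=> x.
have -> : h x = a - (a - h x) by rewrite opprB addrC subrK.
apply: (le_trans (ler_normB _ _)); rewrite lerD2l.
by near: x; move/cvgrPdist_le : ha => /(_ 1 ltr01).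
Unshelve. all: by end_near. Qed.

Lemma loclip_cst c : loclip (fun=> c).
Proof. by exists 0; near=> x; rewrite subrr normr0 mul0r. Unshelve. all: by end_near. Qed.

Lemma loclipD f g : loclip f -> loclip g -> loclip (fun v => f v + g v).
Proof.
move=> [C fC] [D gD]; exists (C + D); near=> x.
have -> : f x.1 + g x.1 - (f x.2 + g x.2) = (f x.1 - f x.2) + (g x.1 - g x.2) by ring.
by rewrite (le_trans (ler_normD _ _))// mulrDl lerD//; near: x.
Unshelve. all: by end_near. Qed.

Lemma loclipM f g : loclip f -> loclip g -> loclip (fun v => f v * g v).
Proof.
move=> Lf Lg; have /cvg_bounded_near fb := loclip_cvg2 Lf.
have /cvg_bounded_near gb := loclip_cvg1 Lg.
move: Lf Lg => [C fC] [D gD].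
exists (C * (`|g p| + 1) + (`|f p| + 1) * D); near=> x.
have -> : f x.1 * g x.1 - f x.2 * g x.2 =
  (f x.1 - f x.2) * g x.1 + f x.2 * (g x.1 - g x.2) by ring.
rewrite (le_trans (ler_normD _ _))// [leRHS]mulrDl lerD// normrM.
  by rewrite mulrAC ler_pM//; near: x.
by rewrite -mulrA ler_pM//; near: x.
Unshelve. all: by end_near. Qed.

Lemma loclipN f : loclip f -> loclip (fun v => - f v).
Proof.
move=> Lf; have -> : (fun v => - f v) = fun v => (-1) * f v.
  by apply/funext => v; rewrite mulN1r.
by apply: loclipM => //; exact: loclip_cst.
Qed.

Lemma loclipV f : f p != 0 -> loclip f -> loclip (fun v => (f v)^-1).
Proof.
move=> fp0 Lf; have f1 := loclip_cvg1 Lf; have f2 := loclip_cvg2 Lf.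
have c1 : (f x.1)^-1 @[x --> (p, p)] --> (f p)^-1 by exact: cvgV.
have c2 : (f x.2)^-1 @[x --> (p, p)] --> (f p)^-1 by exact: cvgV.
have b1 := cvg_bounded_near c1; have b2 := cvg_bounded_near c2.
have n1 : \forall x \near (p, p), f x.1 != 0 by apply: cvgr_neq0 f1 _.
have n2 : \forall x \near (p, p), f x.2 != 0 by apply: cvgr_neq0 f2 _.
move: Lf => [C fC]; exists (C * (`|(f p)^-1| + 1) ^+ 2); near=> x.
have -> : (f x.1)^-1 - (f x.2)^-1 = (f x.2 - f x.1) * ((f x.1)^-1 * (f x.2)^-1).
  by field; apply/andP; split; near: x.
rewrite 2!normrM distrC mulrAC expr2.
by rewrite ler_pM ?mulr_ge0// ?ler_pM//; near: x.
Unshelve. all: by end_near. Qed.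

Lemma loclip_sum (I : Type) (r : seq I) (P : pred I) (f : I -> V -> K) :
  (forall i, loclip (f i)) -> loclip (fun v => \sum_(i <- r | P i) f i v).
Proof.
move=> Lf; elim: r => [|i r IH].
  under eq_fun do rewrite big_nil; exact: loclip_cst.
under eq_fun do rewrite big_cons; case: (P i) => //; exact: loclipD.
Qed.

Lemma loclip_prod (I : Type) (r : seq I) (P : pred I) (f : I -> V -> K) :
  (forall i, loclip (f i)) -> loclip (fun v => \prod_(i <- r | P i) f i v).
Proof.
move=> Lf; elim: r => [|i r IH].
  under eq_fun do rewrite big_nil; exact: loclip_cst.
under eq_fun do rewrite big_cons; case: (P i) => //; exact: loclipM.
Qed.

Lemma loclip_det n (M : V -> 'M[K]_n) :
  (forall i j, loclip (fun v => M v i j)) -> loclip (fun v => \det (M v)).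
Proof.
move=> LM; rewrite /determinant; apply: loclip_sum => s.
by apply: loclipM; [exact: loclip_cst|exact: loclip_prod].
Qed.

(** Cramer's formula. *)
Lemma loclip_invmx n (M : V -> 'M[K]_n) :
  M p \in unitmx -> (forall i j, loclip (fun v => M v i j)) ->
  forall i j, loclip (fun v => invmx (M v) i j).
Proof.
move=> Mp LM i j.
have det_neq0 : \det (M p) != 0 by rewrite -unitfE -unitmxE.
have [C LC] : loclip (fun v => (\det (M v))^-1 * cofactor (M v) j i).
  apply: loclipM; first by apply: loclipV => //; exact: loclip_det.
  rewrite /cofactor; apply: loclipM; first exact: loclip_cst.
  apply: loclip_det => k m.
  by under eq_fun do rewrite !mxE; exact: LM.
exists C.
have n1 : \forall x \near (p, p), \det (M x.1) != 0.
  by apply: cvgr_neq0 (loclip_cvg1 (loclip_det LM)) _.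
have n2 : \forall x \near (p, p), \det (M x.2) != 0.
  by apply: cvgr_neq0 (loclip_cvg2 (loclip_det LM)) _.
near=> x.
have invE (N : 'M[K]_n) : \det N != 0 -> invmx N i j = (\det N)^-1 * cofactor N j i.
  move=> N0; have Nu : N \in unitmx by rewrite unitmxE unitfE.
  by rewrite /invmx Nu !mxE.
by rewrite !invE; near: x.
Unshelve. all: by end_near. Qed.

(** The derivative is strict: the error is small compared with the distance between
    the two points, which are both free.  This is what a comparison of two copies of
    the walk needs. *)
Definition strict_diff f l := loclip f /\
  forall e, 0 < e -> \forall x \near (p, p),
    `|f x.1 - f x.2 - l (x.1 - x.2)| <= e * `|x.1 - x.2|.

Lemma strict_diff_cst c : strict_diff (fun=> c) (fun=> 0).
Proof.
split; first exact: loclip_cst.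
by move=> e e0; near=> x; rewrite subrr subr0 normr0 mulr_ge0// ltW. Unshelve. all: by end_near.
Qed.

Lemma strict_diffD f g lf lg : strict_diff f lf -> strict_diff g lg ->
  strict_diff (fun v => f v + g v) (fun w => lf w + lg w).
Proof.
move=> [Lf Sf] [Lg Sg]; split; first exact: loclipD.
move=> e e0; have e2 : 0 < e / 2 by rewrite divr_gt0.
move: (Sf _ e2) (Sg _ e2) => {}Sf {}Sg; near=> x.
rewrite (_ : _ - _ = (f x.1 - f x.2 - lf (x.1 - x.2)) +
  (g x.1 - g x.2 - lg (x.1 - x.2))); last by ring.
by rewrite (le_trans (ler_normD _ _))// [e]splitr [leRHS]mulrDl lerD//; near: x.
Unshelve. all: by end_near. Qed.

Lemma strict_diff_sum (I : Type) (r : seq I) (f l : I -> V -> K) :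
  (forall i, strict_diff (f i) (l i)) ->
  strict_diff (fun v => \sum_(i <- r) f i v) (fun w => \sum_(i <- r) l i w).
Proof.
move=> Sf; elim: r => [|i r IH].
  rewrite (_ : (fun v => _) = fun=> 0); last by apply/funext => v; rewrite big_nil.
  rewrite (_ : (fun w => _) = fun=> 0); last by apply/funext => v; rewrite big_nil.
  exact: strict_diff_cst.
rewrite (_ : (fun v => _) = fun v => f i v + \sum_(j <- r) f j v); last first.
  by apply/funext => v; rewrite big_cons.
rewrite (_ : (fun w => \sum_(j <- _ :: _) _) = fun v => l i v + \sum_(j <- r) l j v); last first.
  by apply/funext => v; rewrite big_cons.
exact: strict_diffD.
Qed.

(** A product is negligible as soon as one factor tends to 0 and the other is
    Lipschitz. *)
Lemma strict_small (a b : V * V -> K) C :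
  a x @[x --> (p, p)] --> 0 -> (\forall x \near (p, p), `|b x| <= C * `|x.1 - x.2|) ->
  forall e, 0 < e -> \forall x \near (p, p), `|a x * b x| <= e * `|x.1 - x.2|.
Proof.
move=> a0 bC e e0.
have C0 : 0 < `|C| + 1 by rewrite ltr_pwDr.
have aC : \forall x \near (p, p), `|a x| <= e / (`|C| + 1).
  move/cvgrPdist_le : a0 => /(_ (e / (`|C| + 1))); rewrite divr_gt0// => /(_ isT).
  by apply: filterS => x; rewrite sub0r normrN.
near=> x; rewrite normrM.
have bx : `|b x| <= (`|C| + 1) * `|x.1 - x.2|.
  apply: (le_trans (near bC x _)) => //; rewrite ler_wpM2r// (le_trans (ler_norm _))//.
  by rewrite lerDl.
apply: (le_trans (ler_pM _ _ (near aC x _) bx)) => //.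
by rewrite mulrA divfK// gt_eqF.
Unshelve. all: by end_near. Qed.

Lemma strict_diffM f g lf lg : strict_diff f lf -> strict_diff g lg ->
  strict_diff (fun v => f v * g v) (fun w => f p * lg w + g p * lf w).
Proof.
move=> [Lf Sf] [Lg Sg]; split; first exact: loclipM.
move=> e e0; have e3 : 0 < e / 4 by rewrite divr_gt0.
have fcst h c : (forall e, 0 < e -> \forall x \near (p, p), `|h x| <= e * `|x.1 - x.2|) ->
    \forall x \near (p, p), `|c * h x| <= e / 4 * `|x.1 - x.2|.
  move=> hs; have c0 : 0 < `|c| + 1 by rewrite ltr_pwDr.
  have := hs (e / 4 / (`|c| + 1)); rewrite divr_gt0// => /(_ isT) {}hs.
  near=> x; rewrite normrM.
  have -> : e / 4 * `|x.1 - x.2| = (`|c| + 1) * (e / 4 / (`|c| + 1) * `|x.1 - x.2|).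
    by field; rewrite gt_eqF.
  by rewrite ler_pM ?lerDl//; near: x.
have g0 : g x.1 - g p @[x --> (p, p)] --> 0.
  by rewrite -(subrr (g p)); apply: cvgB; [exact: loclip_cvg1|exact: cvg_cst].
have f0 : f x.2 - f p @[x --> (p, p)] --> 0.
  by rewrite -(subrr (f p)); apply: cvgB; [exact: loclip_cvg2|exact: cvg_cst].
have [C fC] := Lf; have [D gD] := Lg.
have E1 := strict_small g0 fC e3; have E2 := strict_small f0 gD e3.
have E3 := fcst _ (g p) Sf; have E4 := fcst _ (f p) Sg.
near=> x.
rewrite (_ : _ - _ = ((g x.1 - g p) * (f x.1 - f x.2) + (f x.2 - f p) * (g x.1 - g x.2))
  + (g p * (f x.1 - f x.2 - lf (x.1 - x.2)) + f p * (g x.1 - g x.2 - lg (x.1 - x.2))));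
  last by ring.
have -> : e * `|x.1 - x.2| = (e / 4 * `|x.1 - x.2| + e / 4 * `|x.1 - x.2|) +
   (e / 4 * `|x.1 - x.2| + e / 4 * `|x.1 - x.2|) by field.
by do 2!rewrite (le_trans (ler_normD _ _))// lerD//; near: x.
Unshelve. all: by end_near. Qed.

Lemma strict_diffV f lf : f p != 0 -> strict_diff f lf ->
  strict_diff (fun v => (f v)^-1) (fun w => - lf w / f p ^+ 2).
Proof.
move=> fp0 [Lf Sf]; split; first exact: loclipV.
move=> e e0; have e2 : 0 < e / 2 by rewrite divr_gt0.
have f1 := loclip_cvg1 Lf; have f2 := loclip_cvg2 Lf.
have n1 : \forall x \near (p, p), f x.1 != 0 by apply: cvgr_neq0 f1 _.
have n2 : \forall x \near (p, p), f x.2 != 0 by apply: cvgr_neq0 f2 _.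
have c0 : (f p ^+ 2)^-1 - (f x.1)^-1 * (f x.2)^-1 @[x --> (p, p)] --> 0.
  rewrite -(subrr (f p ^+ 2)^-1); apply: cvgB; first exact: cvg_cst.
  by rewrite expr2 invfM; apply: cvgM; apply: cvgV.
have [C fC] := Lf; have E1 := strict_small c0 fC e2.
have := Sf (e / 2 * f p ^+ 2).
rewrite mulr_gt0 ?exprn_even_gt0// => /(_ isT) E2.
near=> x.
rewrite (_ : _ - _ = ((f p ^+ 2)^-1 - (f x.1)^-1 * (f x.2)^-1) * (f x.1 - f x.2) -
  (f x.1 - f x.2 - lf (x.1 - x.2)) / f p ^+ 2); last first.
  by field; rewrite fp0 /=; apply/andP; split; near: x.
rewrite (le_trans (ler_normB _ _))// [e]splitr [leRHS]mulrDl lerD//; first by near: x.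
rewrite normrM [`|_^-1|]gtr0_norm ?invr_gt0 ?exprn_even_gt0//.
rewrite ler_pdivrMr ?exprn_even_gt0// mulrAC.
by near: x.
Unshelve. all: by end_near. Qed.

End LocalLipschitz.

Lemma sym_entry (K : Type) d (A : 'M[K]_d) i j : A^T = A -> A i j = A j i.
Proof. by move=> A_sym; rewrite -[in LHS]A_sym mxE. Qed.

(** * Row vectors in the sup norm *)

Section RowNorm.
Variables (K : realType) (d : nat).
Implicit Types (v w p : 'rV[K]_d).

Lemma coord_le_norm w i : `|w 0 i| <= `|w|.
Proof.
rewrite [leRHS]/Num.Def.normr /= mx_normrE.
exact: (le_bigmax _ (fun ij : 'I_1 * 'I_d => `|w ij.1 ij.2|) (0, i)).
Qed.

Lemma row_norm_le w e : 0 <= e -> (forall i, `|w 0 i| <= e) -> `|w| <= e.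
Proof.
move=> e0 we; rewrite /Num.Def.normr /= mx_normrE bigmax_le// => -[i j] _ /=.
by rewrite ord1.
Qed.

Lemma linear_bound (W : normedModType K) (f : {linear 'rV[K]_d -> W}) :
  exists2 C, 0 < C & forall w, `|f w| <= C * `|w|.
Proof.
exists (\sum_i `|f (delta_mx 0 i)| + 1); first by rewrite ltr_pwDr// sumr_ge0.
move=> w; rewrite [w in leLHS]row_sum_delta linear_sum mulrDl mul1r.
rewrite (le_trans (ler_norm_sum _ _ _))// -[leLHS]addr0 lerD// mulr_suml.
apply: ler_sum => i _; rewrite linearZ normrZ mulrC.
by rewrite ler_wpM2l// coord_le_norm.
Qed.

Lemma linear_continuous_row (W : normedModType K) (f : {linear 'rV[K]_d -> W}) :
  continuous f.
Proof.
have [C C0 fC] := linear_bound f; apply: bounded_linear_continuous.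
apply/linear_boundedP; near=> r => w; apply: (le_trans (fC w)).
by rewrite ler_wpM2r//; near: r; apply: nbhs_pinfty_ge; exact: num_real.
Unshelve. all: by end_near. Qed.

Lemma loclip_coord p i : loclip p (fun v => v 0 i).
Proof.
exists 1; near=> x; rewrite mul1r.
by have := coord_le_norm (x.1 - x.2) i; rewrite !mxE.
Unshelve. all: by end_near. Qed.

Lemma strict_diff_coord p i : strict_diff p (fun v => v 0 i) (fun w => w 0 i).
Proof.
split; first exact: loclip_coord.
move=> e e0; near=> x; rewrite !mxE subrr normr0 mulr_ge0// ltW//.
Unshelve. all: by end_near. Qed.

End RowNorm.

Lemma strict_diff_ext (K : realType) (V : normedModType K) (p : V) f l l' :
  l =1 l' -> strict_diff p f l -> strict_diff p f l'.
Proof. by move=> /funext ->. Qed.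

(** * Instability of an interior critical point *)

Section CriticalPoint.
Variables (K : realType) (d : nat) (R : 'M[K]_d) (p : 'rV[K]_d).
Hypotheses (R_sym : R^T = R) (p_critical : critical R p)
  (p_interior : forall i, 0 < p 0 i).
Implicit Types (v w : 'rV[K]_d).
Local Notation h := (Hfun R p).

Lemma critical_H_gt0 : 0 < h. Proof. by case: p_critical. Qed.

Lemma critical_sum : \sum_i p 0 i = 1.
Proof. by case: p_critical => -[]. Qed.

(** At an interior point the fixed point equation p_i N_i(p) / H(p) = p_i can be
    divided by p_i. *)
Lemma critical_N i : Nfun R p i = h.
Proof.
case: p_critical => _ h_gt0 /rowP/(_ i); rewrite mxE => pE.
have p0 : p 0 i != 0 by rewrite gt_eqF.
apply: (mulfI p0); rewrite -[in RHS]pE divfK// gt_eqF//.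
Qed.

Lemma critical_N_sum w : \sum_i p 0 i * Nfun R w i = h * \sum_i w 0 i.
Proof.
rewrite Nfun_sym// mulr_sumr; apply: eq_bigr => i _.
by rewrite critical_N mulrC.
Qed.

Lemma Hfun_critical_add w : Hfun R (p + w) = h + Hfun R w + 2 * h * \sum_i w 0 i.
Proof. by rewrite HfunD// critical_N_sum mulrA. Qed.

(** An interior point can be moved a little in any tangent direction, and p is
    R-orthogonal to the tangent space. *)
Lemma not_simplex_maxP :
  ~ is_simplex_max (Hfun R) p <-> exists2 w, tangent w & 0 < Hfun R w.
Proof.
have [p_simplex _ _] := p_critical.
split=> [notmax|[w w_tan w_pos] [_ pmax]].
  apply: contrapT => /forall2NP no_pos; apply: notmax; split => // v [v_ge0 v_sum].
  have w_tan : tangent (v - p).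
    rewrite /tangent /=; under eq_bigr do rewrite !mxE.
    by rewrite sumrB v_sum critical_sum subrr.
  have [//|/negP] := no_pos (v - p); rewrite -leNgt => H_le0.
  rewrite -[v](subrK p) addrC Hfun_critical_add w_tan mulr0 addr0.
  by rewrite gerDl.
(* for this t every coordinate of p + t w is nonnegative *)
pose t := (1 + \sum_j `|w 0 j| / p 0 j)^-1.
have s_ge0 : 0 <= \sum_j `|w 0 j| / p 0 j.
  by apply: sumr_ge0 => j _; rewrite divr_ge0// ltW.
have t_gt0 : 0 < t by rewrite invr_gt0 ltr_pwDl.
have : Hfun R (p + t *: w) <= h.
  apply: pmax; split; last first.
    under eq_bigr do rewrite !mxE.
    by rewrite big_split /= -mulr_sumr w_tan mulr0 addr0 critical_sum.
  move=> i; rewrite !mxE.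
  suff : t * `|w 0 i| <= p 0 i.
    by have := ler_norm (- (t * w 0 i)); rewrite normrN normrM gtr0_norm//; lra.
  have wi : `|w 0 i| / p 0 i <= 1 + \sum_j `|w 0 j| / p 0 j.
    rewrite (bigD1 i)//= addrCA lerDl addr_ge0// sumr_ge0// => j _.
    by rewrite divr_ge0// ltW.
  by rewrite mulrC -ler_pdivlMr// /t invrK [leRHS]mulrC -ler_pdivrMr.
have tw_tan : \sum_i (t *: w) 0 i = 0.
  by under eq_bigr do rewrite mxE; rewrite -mulr_sumr w_tan mulr0.
rewrite Hfun_critical_add tw_tan HfunZ => le_h.
have : 0 < t ^+ 2 * Hfun R w by rewrite mulr_gt0// exprn_gt0.
by move: le_h; lra.
Qed.

(** The critical point p is itself a positive direction, R-orthogonal to W. *)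
Lemma not_simplex_max_eigenvalues :
  ~ is_simplex_max (Hfun R) p <-> (1 < num_pos_eigenvalues R)%N.
Proof.
rewrite not_simplex_maxP; split; last exact: two_pos_eigenvalues_tangent.
move=> [w w_tan w_pos]; apply: (two_pos_orthogonal_eigenvalues R_sym critical_H_gt0 w_pos).
by rewrite critical_N_sum w_tan mulr0.
Qed.

(** The derivative of pi - I at p, on the whole space. *)
Definition dpi w : 'rV[K]_d :=
  \row_i (p 0 i * Nfun R w i / h - 2 * p 0 i * \sum_j w 0 j).

Lemma strict_diff_N i : strict_diff p (fun v => Nfun R v i) (fun w => Nfun R w i).
Proof.
rewrite /Nfun; apply: strict_diff_sum => j.
apply: strict_diff_ext (strict_diffM (strict_diff_cst _ _) (strict_diff_coord p j)) => w.
by rewrite mulr0 addr0.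
Qed.

Lemma strict_diff_vN i : strict_diff p (fun v => v 0 i * Nfun R v i)
  (fun w => p 0 i * Nfun R w i + h * w 0 i).
Proof.
apply: strict_diff_ext (strict_diffM (strict_diff_coord p i) (strict_diff_N i)) => w.
by rewrite critical_N.
Qed.

Lemma strict_diff_H : strict_diff p (Hfun R) (fun w => 2 * h * \sum_i w 0 i).
Proof.
apply: strict_diff_ext (strict_diff_sum _ strict_diff_vN) => w.
by rewrite big_split /= critical_N_sum -mulr_sumr; ring.
Qed.

Lemma strict_diff_pimap i : strict_diff p (fun v => pimap R v 0 i)
  (fun w => w 0 i + dpi w 0 i).
Proof.
have h0 : h != 0 by rewrite gt_eqF// critical_H_gt0.
under eq_fun do rewrite mxE.
apply: strict_diff_ext (strict_diffM (strict_diff_vN i) (strict_diffV h0 strict_diff_H)) => w.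
rewrite mxE critical_N; field; exact: h0.
Qed.

Lemma pimap_strict e : 0 < e -> \forall x \near (p, p),
  `|pimap R x.1 - pimap R x.2 - (x.1 - x.2 + dpi (x.1 - x.2))| <= e * `|x.1 - x.2|.
Proof.
move=> e0; near=> x; apply: row_norm_le; first by rewrite mulr_ge0// ltW.
have : forall i, `|pimap R x.1 0 i - pimap R x.2 0 i -
   ((x.1 - x.2) 0 i + dpi (x.1 - x.2) 0 i)| <= e * `|x.1 - x.2|.
  near: x; apply: filter_forall => i.
  by have [_ /(_ e e0)] := strict_diff_pimap i.
by move=> H i; have := H i; rewrite !mxE.
Unshelve. all: by end_near. Qed.

Fact dpi_is_linear : linear dpi.
Proof.
move=> c u v; apply/rowP => i; rewrite !mxE NfunD NfunZ.
under eq_bigr do rewrite !mxE.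
by rewrite big_split /= -mulr_sumr; ring.
Qed.

HB.instance Definition _ := GRing.isLinear.Build K _ _ _ dpi dpi_is_linear.

Lemma pi_derivativeE : pi_derivative R p = dpi.
Proof.
rewrite /pi_derivative; apply: diff_unique; first exact: linear_continuous_row.
apply/eqaddoP => e e0.
have cvg_pp : (w + p, p) @[w --> (0 : 'rV[K]_d)] --> (p, p).
  have c1 : w + p @[w --> (0 : 'rV[K]_d)] --> p.
    have cont : continuous (fun w : 'rV[K]_d => w + p).
      by move=> w; apply: (@cvgD _ _ _ (nbhs w)); [exact: cvg_id|exact: cvg_cst].
    by have := cont 0; rewrite /continuous_at add0r.
  exact: (cvg_pair c1 (cvg_cst p)).
have E : \forall w \near (0 : 'rV[K]_d), `|pimap R (w + p) - pimap R p -
   (w + p - p + dpi (w + p - p))| <= e * `|w + p - p| := cvg_pp _ (pimap_strict e0).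
near=> w; have : `|pimap R (w + p) - pimap R p -
   (w + p - p + dpi (w + p - p))| <= e * `|w + p - p| by near: w.
rewrite addrK; congr (`|_| <= _).
rewrite !fctE /=; apply/rowP => i; rewrite !mxE; ring.
Unshelve. all: by end_near. Qed.

(** With q_i the square root of p_i, the derivative on W is conjugate to the symmetric
    matrix (q_i R_ij q_j); subtracting h q_i q_j removes the eigenvector q, which
    corresponds to the direction p outside W. *)
Lemma tangent_eigenvalueP :
  (exists2 a : K, 0 < a & tangent_eigenvalue (pi_derivative R p) a) <->
  exists2 w, tangent w & 0 < Hfun R w.
Proof.
have h_gt0 := critical_H_gt0; rewrite pi_derivativeE; split.
  move=> [a a_gt0 [w [w_tan w_neq0 w_eig]]]; exists w => //.
  have wE i : Nfun R w i = a * h * w 0 i / p 0 i.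
    have /rowP/(_ i) := w_eig; rewrite !mxE w_tan mulr0 subr0 => E.
    have -> : a * h * w 0 i = p 0 i * Nfun R w i.
      by rewrite mulrAC -E divfK// gt_eqF.
    by rewrite mulrC mulKf// gt_eqF.
  have [i wi] : exists i, w 0 i != 0.
    apply: contrapT => /forallNP wz; move/eqP: w_neq0; apply; apply/rowP => i.
    by rewrite mxE; apply/eqP/negPn/negP/wz.
  have t_ge0 j : 0 <= w 0 j * Nfun R w j.
    rewrite wE [X in 0 <= X](_ : _ = a * h * (w 0 j ^+ 2 / p 0 j)); last by ring.
    apply: mulr_ge0; first by rewrite mulr_ge0// ltW.
    by rewrite mulr_ge0 ?sqr_ge0// invr_ge0 ltW.
  rewrite /Hfun (bigD1 i)//= ltr_pwDl ?sumr_ge0//.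
  rewrite wE [X in 0 < X](_ : _ = a * h * (w 0 i ^+ 2 / p 0 i)); last by ring.
  apply: mulr_gt0; first by rewrite mulr_gt0.
  by rewrite mulr_gt0 ?invr_gt0// exprn_even_gt0.
move=> [w w_tan w_pos].
pose q i := Num.sqrt (p 0 i).
have q_gt0 i : 0 < q i by rewrite sqrtr_gt0.
have qq i : q i * q i = p 0 i by rewrite -expr2 sqr_sqrtr// ltW.
pose M : 'M[K]_d := \matrix_(i, j) (q i * R i j * q j - h * q i * q j).
have M_sym : M^T = M.
  by apply/matrixP => i j; rewrite !mxE (sym_entry _ _ R_sym); ring.
have NM u i : Nfun M u i = q i * (Nfun R (\row_j (q j * u 0 j)) i - h * \sum_j q j * u 0 j).
  rewrite mulrBr /Nfun !mulr_sumr -sumrB; apply: eq_bigr => j _.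
  by rewrite !mxE; ring.
have [a a_gt0 [u u_neq0 u_eig]] : exists2 a : K, 0 < a &
    exists2 u : 'rV[K]_d, u != 0 & u *m M = a *: u.
  apply: (@sym_pos_eigenvector _ _ _ (\row_i (w 0 i / q i))) => //.
  rewrite /Hfun; under eq_bigr => i _.
    rewrite NM mxE mulrA divfK ?gt_eqF//.
    have -> : \row_j (q j * (\row_i (w 0 i / q i)) 0 j) = w.
      by apply/rowP => j; rewrite !mxE mulrC divfK// gt_eqF.
    have -> : \sum_j q j * (\row_i (w 0 i / q i)) 0 j = 0.
      rewrite -[RHS]w_tan; apply: eq_bigr => j _.
      by rewrite !mxE mulrC divfK// gt_eqF.
    rewrite mulr0 subr0; over.
  exact: w_pos.
have NMu i : Nfun M u i = a * u 0 i.
  have /rowP/(_ i) := u_eig; rewrite !mxE => <-; apply: eq_bigr => j _.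
  by rewrite (sym_entry _ _ M_sym) mulrC.
have qu0 : \sum_i q i * u 0 i = 0.
  have : \sum_i q i * Nfun M u i = 0.
    under eq_bigr do rewrite NM mulrA qq mulrBr.
    rewrite sumrB critical_N_sum -mulr_suml critical_sum mul1r.
    by under eq_bigr do rewrite mxE; rewrite subrr.
  under eq_bigr do rewrite NMu mulrCA.
  rewrite -mulr_sumr => /eqP; rewrite mulf_eq0 gt_eqF//= => /eqP //.
exists (a / h); first by rewrite divr_gt0.
exists (\row_i (q i * u 0 i)); split.
- by rewrite /tangent /=; under eq_bigr do rewrite mxE.
- apply: contra_neq u_neq0 => /rowP qz; apply/rowP => i.
  by have /eqP := qz i; rewrite !mxE mulf_eq0 gt_eqF//= => /eqP.
apply/rowP => i; rewrite !mxE.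
under [\sum_j _]eq_bigr do rewrite mxE.
rewrite qu0 mulr0 subr0 -qq.
have := NM u i; rewrite qu0 mulr0 subr0 NMu => E.
by rewrite -[q i * q i * _]mulrA -E; ring.
Qed.

End CriticalPoint.

(** * The transition kernel and its Poisson equation *)

Section Kernel.
Variables (K : realType) (d : nat) (R : 'M[K]_d).
Implicit Types (s v w p : 'rV[K]_d).

Definition kern s (y j : 'I_d) : K := R y j * s 0 j / Nfun R s y.

Definition kernmx s : 'M[K]_d := \matrix_(y, j) kern s y j.

(** The Poisson equation of the kernel is solved by the inverse of this matrix: the
    rank one term makes I - K_s invertible when the constants are the only harmonic
    functions of K_p, for s close to p. *)
Definition fundmx p s : 'M[K]_d := 1%:M - kernmx s + \matrix_(y, j) p 0 j.

Lemma kern_scale c s y j : c != 0 -> kern (c *: s) y j = kern s y j.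
Proof.
move=> c0; rewrite /kern NfunZ mxE mulrCA -mulf_div divff// mul1r //.
Qed.

Lemma fundmx_scale p c s : c != 0 -> fundmx p (c *: s) = fundmx p s.
Proof.
move=> c0; congr (_ - _ + _).
by apply/matrixP => y j; rewrite !mxE kern_scale.
Qed.

Lemma kern_sum s y : Nfun R s y != 0 -> \sum_j kern s y j = 1.
Proof. by move=> N0; rewrite -mulr_suml divff. Qed.

Lemma kern_ge0 s y j : (forall i j, 0 <= R i j) -> (forall j, 0 <= s 0 j) ->
  0 <= kern s y j.
Proof.
move=> R_ge0 s_ge0; rewrite divr_ge0 ?mulr_ge0// sumr_ge0// => i _.
by rewrite mulr_ge0.
Qed.

Section Poisson.
Variables (p s : 'rV[K]_d).
Hypotheses (R_sym : R^T = R) (p_sum : \sum_i p 0 i = 1).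
Hypotheses (N0 : forall y, Nfun R s y != 0) (H0 : Hfun R s != 0).
Hypothesis (Q_unit : fundmx p s \in unitmx).
Local Notation G := (invmx (fundmx p s)).

Lemma pimap_sum : \sum_i pimap R s 0 i = 1.
Proof. by under eq_bigr do rewrite mxE; rewrite -mulr_suml divff. Qed.

(** Reversibility: s_i N_i(s) K_s(i,j) = s_i R_ij s_j is symmetric in i and j. *)
Lemma pimap_invariant : pimap R s *m kernmx s = pimap R s.
Proof.
apply/rowP => j; rewrite mxE.
rewrite (eq_bigr (fun i => R j i * s 0 i * (s 0 j / Hfun R s))).
  by rewrite -mulr_suml mxE mulrA (mulrC (s 0 j)).
move=> i _; rewrite !mxE /kern (sym_entry _ _ R_sym).
by field; rewrite H0 N0.
Qed.

Lemma pimap_poisson : p *m G = pimap R s.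
Proof.
have E : pimap R s *m fundmx p s = p.
  rewrite mulmxDr mulmxBr mulmx1 pimap_invariant subrr add0r.
  apply/rowP => j; rewrite mxE; under eq_bigr do rewrite [X in _ * X]mxE.
  by rewrite -mulr_suml pimap_sum mul1r.
by transitivity (pimap R s *m fundmx p s *m G); [rewrite E|rewrite mulmxK].
Qed.

(** The inverse G of [fundmx] satisfies (I - K_s) G = I - 1 pi(s), because p G is the
    invariant law pi(s). *)
Lemma poisson_eq : kernmx s *m G = G - 1%:M + \matrix_(y, j) pimap R s 0 j.
Proof.
have := mulmxV Q_unit; rewrite mulmxDl mulmxBl mul1mx.
have -> : (\matrix_(y, j) p 0 j : 'M[K]_d) *m G = \matrix_(y, j) pimap R s 0 j.
  apply/matrixP => y j; rewrite -pimap_poisson !mxE.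
  by apply: eq_bigr => i _; rewrite mxE.
by move=> <-; rewrite opprD opprB addrA subrK addrC subrK.
Qed.

Lemma poisson_row_sum y : \sum_j G y j = 1.
Proof.
have E : fundmx p s *m const_mx 1 = (const_mx 1 : 'cV[K]_d).
  apply/colP => i; rewrite mxE (eq_bigr (fun j => (i == j)%:R - kern s i j + p 0 j)).
    rewrite !big_split /= p_sum sumrN kern_sum// mxE (bigD1 i)//= big1 => [|j ji].
      by rewrite eqxx addr0 subrK.
    by rewrite eq_sym (negbTE ji).
  by move=> j _; rewrite !mxE mulr1.
have : (G *m const_mx 1 : 'cV[K]_d) = const_mx 1 by rewrite -[in LHS]E mulKmx.
move/colP/(_ y); rewrite !mxE => <-.
by apply: eq_bigr => j _; rewrite mxE mulr1.
Qed.

End Poisson.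
End Kernel.

Section LocalKernel.
Variables (K : realType) (d : nat) (R : 'M[K]_d) (p : 'rV[K]_d).
Hypotheses (R_sym : R^T = R) (R_ge0 : forall i j, 0 <= R i j)
  (p_critical : critical R p) (p_interior : forall i, 0 < p 0 i).
Implicit Types (v w : 'rV[K]_d).
Hypothesis (Q_unit : fundmx R p p \in unitmx).

Lemma loclip_N i : loclip p (fun v => Nfun R v i).
Proof. by have [] := strict_diff_N R p i. Qed.

Lemma loclip_kern y j : loclip p (fun v => kern R v y j).
Proof.
apply: loclipM; last first.
  by apply: loclipV; [rewrite critical_N// gt_eqF// critical_H_gt0|exact: loclip_N].
by apply: loclipM; [exact: loclip_cst|exact: loclip_coord].
Qed.

Lemma loclip_fundmx y j : loclip p (fun v => fundmx R p v y j).
Proof.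
under eq_fun do rewrite !mxE.
apply: loclipD; last exact: loclip_cst.
by apply: loclipD; [exact: loclip_cst|apply: loclipN; exact: loclip_kern].
Qed.

Lemma loclip_poisson y j : loclip p (fun v => invmx (fundmx R p v) y j).
Proof. by apply: loclip_invmx => // *; exact: loclip_fundmx. Qed.

(** The conditions under which the identities for the kernel at v hold exactly. *)
Definition regular v :=
  [/\ forall i, 0 < v 0 i, forall i, 0 < Nfun R v i, 0 < Hfun R v &
      fundmx R p v \in unitmx].

Lemma near_regular : \forall v \near p, regular v.
Proof.
have gt0 (f : 'rV[K]_d -> K) : loclip p f -> 0 < f p -> \forall v \near p, 0 < f v.
  by move=> /loclip_cvg fp fp0; exact: (cvgr_gt _ fp _ fp0).
have h_gt0 := critical_H_gt0 p_critical.
have v_gt0 : nbhs p [set v : 'rV[K]_d | forall i, 0 < v 0 i].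
  apply: (@filter_forall _ _ (fun i (v : 'rV[K]_d) => 0 < v 0 i) (nbhs p) _) => i.
  by apply: gt0; [exact: loclip_coord|exact: p_interior].
have N_gt0 : nbhs p [set v : 'rV[K]_d | forall i, 0 < Nfun R v i].
  apply: (@filter_forall _ _ (fun i (v : 'rV[K]_d) => 0 < Nfun R v i) (nbhs p) _) => i.
  by apply: gt0; [exact: loclip_N|rewrite critical_N].
have H_gt0 : nbhs p [set v : 'rV[K]_d | 0 < Hfun R v].
  by apply: gt0 => //; have [] := strict_diff_H R_sym p_critical p_interior.
have D_gt0 : nbhs p [set v : 'rV[K]_d | \det (fundmx R p v) != 0].
  have := loclip_cvg (loclip_det loclip_fundmx).
  by move/cvgr_neq0; apply; rewrite -unitfE -unitmxE.
apply: filterS3 (filterI v_gt0 N_gt0) H_gt0 D_gt0 => v /= [v0 N0] H0 D0.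
by split; rewrite // unitmxE unitfE.
Qed.

End LocalKernel.

(** * Quadratic forms: bounds and coercivity *)

Section Bounds.
Variables (K : realType) (d : nat).
Implicit Types (A R : 'M[K]_d) (u v w : 'rV[K]_d).

Definition Bform A u w : K := \sum_i u 0 i * Nfun A w i.

Lemma BformDr A u v w : Bform A u (v + w) = Bform A u v + Bform A u w.
Proof. by rewrite -big_split; apply: eq_bigr => i _; rewrite NfunD mulrDr. Qed.

Lemma BformZr A c u w : Bform A u (c *: w) = c * Bform A u w.
Proof. by rewrite /Bform mulr_sumr; apply: eq_bigr => i _; rewrite NfunZ; ring. Qed.

Lemma Bform_sumr A (I : Type) (r : seq I) (c : I -> K) (f : I -> 'rV[K]_d) u :
  Bform A u (\sum_(k <- r) c k *: f k) = \sum_(k <- r) c k * Bform A u (f k).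
Proof.
elim: r => [|k r IH]; last by rewrite !big_cons BformDr BformZr IH.
rewrite !big_nil /Bform big1// => i _.
by rewrite /Nfun big1 ?mulr0// => j _; rewrite mxE mulr0.
Qed.

Lemma Bform_sym A u w : A^T = A -> Bform A u w = Bform A w u.
Proof. exact: Nfun_sym. Qed.

Lemma Hfun_Bform A u w c : A^T = A ->
  Hfun A (u + c *: w) = Hfun A u + 2 * c * Bform A u w + c ^+ 2 * Hfun A w.
Proof.
by move=> A_sym; rewrite HfunD// HfunZ -/(Bform A u (c *: w)) BformZr; ring.
Qed.

Lemma Bform_bound A : exists2 C, 0 < C & forall u w, `|Bform A u w| <= C * `|u| * `|w|.
Proof.
exists (\sum_i \sum_j `|A i j| + 1).
  by rewrite ltr_pwDr// sumr_ge0// => i _; rewrite sumr_ge0.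
move=> u w; rewrite -mulrA mulrDl mul1r -[leLHS]addr0 lerD ?mulr_ge0//.
rewrite (le_trans (ler_norm_sum _ _ _))// mulr_suml; apply: ler_sum => i _.
rewrite normrM [leRHS]mulrCA ler_pM ?coord_le_norm//.
rewrite (le_trans (ler_norm_sum _ _ _))// mulr_suml; apply: ler_sum => j _.
by rewrite normrM ler_wpM2l ?coord_le_norm.
Qed.

Lemma Hfun_bound A : exists2 C, 0 < C & forall u, `|Hfun A u| <= C * `|u| ^+ 2.
Proof.
have [C C0 AC] := Bform_bound A; exists C => // u.
by rewrite expr2 mulrA; exact: AC.
Qed.

(** R is invertible, so w is controlled by the vector of the N_i(w). *)
Lemma N_coercive R (c : 'I_d -> K) : R^T = R -> R \in unitmx -> (forall i, 0 < c i) ->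
  exists2 m, 0 < m & forall w, m * `|w| ^+ 2 <= \sum_i c i * Nfun R w i ^+ 2.
Proof.
move=> R_sym R_unit c_gt0.
have [C C0 fC] := @linear_bound _ _ _ (@mulmxr K 1 d d (invmx R)).
pose P := \sum_j (c j)^-1 + 1.
have P_gt0 : 0 < P by rewrite ltr_pwDr// sumr_ge0// => j _; rewrite invr_ge0 ltW.
exists (C ^+ 2 * P)^-1; first by rewrite invr_gt0 mulr_gt0// exprn_gt0.
move=> w; set S := \sum_i _.
have S_ge0 : 0 <= S by rewrite sumr_ge0// => i _; rewrite mulr_ge0 ?sqr_ge0// ltW.
have wE : w = (w *m R) *m invmx R by rewrite mulmxK.
have wRE i : (w *m R) 0 i = Nfun R w i.
  by rewrite mxE; apply: eq_bigr => j _; rewrite mulrC (sym_entry _ _ R_sym).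
have wR : `|w *m R| <= Num.sqrt (S * P).
  apply: row_norm_le; first exact: sqrtr_ge0.
  move=> i; rewrite -(sqrtr_sqr ((w *m R) 0 i)) ler_wsqrtr// wRE.
  have Si : c i * Nfun R w i ^+ 2 <= S.
    rewrite /S (bigD1 i)//= lerDl sumr_ge0// => j _.
    by rewrite mulr_ge0 ?sqr_ge0// ltW.
  have Pi : (c i)^-1 <= P.
    rewrite /P (bigD1 i)//= -addrA lerDl addr_ge0// sumr_ge0// => j _.
    by rewrite invr_ge0 ltW.
  have -> : Nfun R w i ^+ 2 = c i * Nfun R w i ^+ 2 * (c i)^-1.
    by rewrite mulrAC divff ?mul1r// gt_eqF.
  by rewrite ler_pM// ?invr_ge0 ?(ltW (c_gt0 i))// mulr_ge0 ?sqr_ge0// ltW.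
have w_le : `|w| <= C * Num.sqrt (S * P).
  by rewrite [w in leLHS]wE; apply: (le_trans (fC (w *m R))); rewrite ler_pM2l.
rewrite ler_pdivrMl ?mulr_gt0 ?exprn_gt0// mulrAC -mulrA.
have -> : C ^+ 2 * (S * P) = (C * Num.sqrt (S * P)) ^+ 2.
  by rewrite exprMn sqr_sqrtr// mulr_ge0// ltW.
by rewrite ler_sqr ?nnegrE// mulr_ge0 ?sqrtr_ge0// ltW.
Qed.

End Bounds.

(** * A form whose noise is positive on average *)

Section Noise.
Variables (K : realType) (d : nat) (R : 'M[K]_d) (p : 'rV[K]_d).
Hypotheses (R_sym : R^T = R) (R_ge0 : forall i j, 0 <= R i j)
  (R_unit : R \in unitmx)
  (p_critical : critical R p) (p_interior : forall i, 0 < p 0 i).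
Implicit Types (v w u : 'rV[K]_d).
Hypothesis (Q_unit : fundmx R p p \in unitmx).
Variables (a : K) (th : 'I_d -> K).
Hypotheses (a_gt0 : 0 < a) (th_eig : forall y, \sum_j kern R p y j * th j = a * th y)
  (th_mean : \sum_i p 0 i * th i = 0) (th_neq0 : exists i, th i != 0).
Local Notation h := (Hfun R p).
Local Notation G := (invmx (fundmx R p p)).

(** The unstable direction th is given a large weight M, so that the noise along it
    outweighs the possibly negative noise of H in the other directions. *)
Definition boosted_form (M : K) : 'M[K]_d := R + M *: \matrix_(i, j) (th i * th j).

Definition th_dot u := \sum_i th i * u 0 i.

Lemma boosted_form_sym M : (boosted_form M)^T = boosted_form M.
Proof.
apply/matrixP => i j; rewrite !mxE (sym_entry _ _ R_sym); ring.
Qed.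

Lemma Nfun_boosted_form M u i : Nfun (boosted_form M) u i = Nfun R u i + M * th i * th_dot u.
Proof.
rewrite /Nfun /th_dot mulr_sumr -big_split; apply: eq_bigr => j _.
by rewrite !mxE /=; ring.
Qed.

Lemma Hfun_boosted_form M u : Hfun (boosted_form M) u = Hfun R u + M * th_dot u ^+ 2.
Proof.
rewrite /Hfun; under eq_bigr do rewrite Nfun_boosted_form mulrDr.
rewrite big_split /=; congr (_ + _).
rewrite (eq_bigr (fun i => M * th_dot u * (th i * u 0 i))).
  by rewrite -mulr_sumr -/(th_dot u); ring.
by move=> i _; ring.
Qed.

Lemma kern_p y j : kern R p y j = R y j * p 0 j / h.
Proof. by rewrite /kern critical_N. Qed.

(** The kernel at p is reversible, hence p is invariant. *)
Lemma p_kern_sum (f : 'I_d -> K) :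
  \sum_y p 0 y * \sum_j kern R p y j * f j = \sum_j p 0 j * f j.
Proof.
under eq_bigr do rewrite mulr_sumr; rewrite exchange_big /=.
apply: eq_bigr => j _; rewrite (eq_bigr (fun y => R j y * p 0 y * (p 0 j * f j / h))).
  rewrite -mulr_suml -/(Nfun R p j) critical_N//; field; rewrite gt_eqF ?(critical_H_gt0 p_critical)//.
by move=> y _; rewrite kern_p (sym_entry _ _ R_sym); ring.
Qed.

Lemma th_dot_dpi w : tangent w -> th_dot (dpi R p w) = a * th_dot w.
Proof.
move=> w_tan; rewrite /th_dot mulr_sumr.
rewrite (eq_bigr (fun i => \sum_j th i * p 0 i * R i j * w 0 j / h)).
  rewrite exchange_big /=; apply: eq_bigr => j _.
  rewrite mulrA -th_eig mulr_suml; apply: eq_bigr => i _.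
  by rewrite kern_p (sym_entry _ _ R_sym); ring.
move=> i _; rewrite mxE w_tan mulr0 subr0 /Nfun mulr_sumr mulr_suml mulr_sumr.
by apply: eq_bigr => j _; ring.
Qed.

(** For w in W, the pairing of w with dpi w is h^-1 times the sum of the p_i N_i(w)^2
    for the form H, and M a (th . w)^2 >= 0 for the boost. *)
Lemma drift_coercive M : 0 <= M -> exists2 m, 0 < m &
  forall w, tangent w -> m * `|w| ^+ 2 <= Bform (boosted_form M) w (dpi R p w).
Proof.
move=> M_ge0.
have [m m_gt0 mP] := @N_coercive _ _ R (fun i => p 0 i / h) R_sym R_unit
  (fun i => divr_gt0 (p_interior i) (critical_H_gt0 p_critical)).
exists m => // w w_tan; rewrite Bform_sym ?boosted_form_sym//; apply: (le_trans (mP w)).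
rewrite /Bform; under [leRHS]eq_bigr do rewrite Nfun_boosted_form mulrDr.
rewrite big_split /= -[leLHS]addr0 lerD//.
  apply: ler_sum => i _; rewrite mxE w_tan mulr0 subr0 le_eqVlt; apply/orP.
  by left; apply/eqP; ring.
rewrite (_ : \sum_(i < d) _ = M * a * th_dot w ^+ 2).
  by rewrite mulr_ge0 ?sqr_ge0// mulr_ge0// ltW.
transitivity (M * th_dot w * th_dot (dpi R p w)); last by rewrite th_dot_dpi//; ring.
by rewrite /th_dot [RHS]mulr_sumr; apply: eq_bigr => i _; rewrite /th_dot; ring.
Qed.

(** The increment of the corrected process at a step from y to j, with the kernel
    frozen at p.  Its mean is p, whatever y is. *)
Definition noise y j : 'rV[K]_d := delta_mx 0 y - row y G + row j G.

Definition noise_var M y : K := \sum_j kern R p y j * Hfun (boosted_form M) (noise y j - p).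

Lemma poisson_p : kernmx R p *m G = G - 1%:M + \matrix_(y, j) p 0 j.
Proof.
have [_ _ pE] := p_critical.
rewrite poisson_eq ?pE// => [y|]; rewrite ?critical_N// gt_eqF// (critical_H_gt0 p_critical)//.
Qed.

Lemma kern_p_sum y : \sum_j kern R p y j = 1.
Proof. by rewrite kern_sum// critical_N// gt_eqF// (critical_H_gt0 p_critical). Qed.

Lemma kern_p_ge0 y j : 0 <= kern R p y j.
Proof. by rewrite kern_ge0// => i; rewrite ltW. Qed.

Lemma noise_mean y : \sum_j kern R p y j *: (noise y j - p) = 0.
Proof.
apply/rowP => k; rewrite summxE mxE.
have /matrixP/(_ y k) := poisson_p; rewrite mxE.
rewrite (eq_bigr (fun j => kern R p y j * G j k)) => [E|j _]; last by rewrite mxE.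
rewrite (eq_bigr (fun j => kern R p y j * G j k +
   kern R p y j * ((y == k)%:R - G y k - p 0 k))).
  rewrite big_split /= E -mulr_suml kern_p_sum !mxE; ring.
by move=> j _; rewrite !mxE eqxx /= eq_sym; ring.
Qed.

(** th is an eigenfunction of the kernel at p, hence of the solution operator of the
    Poisson equation. *)
Lemma th_poisson y : (1 - a) * \sum_j G y j * th j = th y.
Proof.
pose t : 'cV[K]_d := \col_j th j.
have E : fundmx R p p *m t = (1 - a) *: t.
  apply/colP => i; rewrite mxE.
  rewrite (eq_bigr (fun j => (i == j)%:R * th j - kern R p i j * th j + p 0 j * th j)).
    rewrite !big_split /= sumrN th_eig th_mean (bigD1 i)//= big1 => [|j ji].
      by rewrite eqxx !mxE /=; ring.
    by rewrite eq_sym (negbTE ji) mul0r.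
  by move=> j _; rewrite !mxE; ring.
have : t = (1 - a) *: (G *m t) by rewrite scalemxAr -E mulKmx.
move/colP/(_ y); rewrite !mxE => ->; congr (_ * _).
by apply: eq_bigr => j _; rewrite mxE.
Qed.

Lemma eigenvalue_neq1 : a != 1.
Proof.
apply/eqP => a1; have [i /eqP] := th_neq0; apply.
by rewrite -th_poisson a1 subrr mul0r.
Qed.

(** Along th the noise is a multiple of th_j - a th_y, the martingale increment of the
    eigenfunction. *)
Lemma th_dot_noise y j : (1 - a) * th_dot (noise y j - p) = th j - a * th y.
Proof.
have -> : th_dot (noise y j - p) =
   th y - \sum_k G y k * th k + \sum_k G j k * th k - \sum_k p 0 k * th k.
  rewrite {1}(_ : th y = \sum_k th k * (k == y)%:R); last first.
    by rewrite (bigD1 y)//= eqxx mulr1 big1 ?addr0// => k /negbTE ->; rewrite mulr0.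
  rewrite -!sumrN -!big_split /=; apply: eq_bigr => k _.
  by rewrite !mxE eqxx /=; ring.
rewrite th_mean -(th_poisson j) -[in RHS](th_poisson y) -[in LHS](th_poisson y).
ring.
Qed.

(** By invariance of p, the mean of (th_j - a th_y)^2 is (1 - a^2) times the mean of
    th^2.  Being nonnegative it forces a <= 1, and a = 1 is excluded by the
    invertibility of [fundmx].  A single y may contribute nothing: from a leaf of the
    graph the next step is deterministic. *)
Lemma noise_energy : 0 < \sum_y p 0 y * \sum_j kern R p y j * th_dot (noise y j - p) ^+ 2.
Proof.
set s := (X in 0 < X).
have s_ge0 : 0 <= s.
  apply: sumr_ge0 => y _; rewrite mulr_ge0 ?sumr_ge0 ?ltW// => j _.
  by rewrite mulr_ge0 ?sqr_ge0 ?kern_p_ge0.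
pose t := \sum_y p 0 y * th y ^+ 2.
have t_gt0 : 0 < t.
  have [i ti] := th_neq0; rewrite /t (bigD1 i)//= ltr_pwDl//.
    by rewrite mulr_gt0// exprn_even_gt0.
  by rewrite sumr_ge0// => j _; rewrite mulr_ge0 ?sqr_ge0// ltW.
have E : (1 - a) ^+ 2 * s = (1 - a ^+ 2) * t.
  rewrite mulr_sumr.
  rewrite (eq_bigr (fun y => p 0 y * \sum_j kern R p y j * th j ^+ 2
      - a ^+ 2 * (p 0 y * th y ^+ 2))).
    by rewrite big_split /= p_kern_sum sumrN -mulr_sumr /t; ring.
  move=> y _.
  have -> : (1 - a) ^+ 2 * (p 0 y * \sum_j kern R p y j * th_dot (noise y j - p) ^+ 2) =
    p 0 y * \sum_j kern R p y j * (th j - a * th y) ^+ 2.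
    rewrite mulrCA; congr (_ * _); rewrite mulr_sumr; apply: eq_bigr => j _.
    by rewrite -th_dot_noise; ring.
  have -> : \sum_j kern R p y j * (th j - a * th y) ^+ 2 =
     \sum_j kern R p y j * th j ^+ 2 - 2 * a * th y * (\sum_j kern R p y j * th j)
     + a ^+ 2 * th y ^+ 2 * \sum_j kern R p y j.
    rewrite !mulr_sumr -sumrB -big_split; apply: eq_bigr => j _ /=; ring.
  by rewrite th_eig kern_p_sum; ring.
have a1 : (1 - a) != 0 by rewrite subr_eq0 eq_sym eigenvalue_neq1.
have sq_gt0 : 0 < (1 - a) ^+ 2 by rewrite exprn_even_gt0.
rewrite -(pmulr_rgt0 _ sq_gt0) E pmulr_lgt0//.
have : 0 <= (1 - a ^+ 2) * t by rewrite -E mulr_ge0// ltW.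
rewrite pmulr_lge0// => a2.
rewrite lt_def a2 andbT; apply: contra a1 => /eqP H.
have : (1 - a) * (1 + a) = 0 by rewrite -H; ring.
by move/eqP; rewrite mulf_eq0 => /orP[//|]; rewrite gt_eqF// ltr_wpDr// ltW.
Qed.

Lemma noise_var_gt0 : exists2 M, 0 <= M & 0 < \sum_y p 0 y * noise_var M y.
Proof.
pose s0 := \sum_y p 0 y * \sum_j kern R p y j * Hfun R (noise y j - p).
have := noise_energy; set s := (X in 0 < X) => s_gt0.
exists ((`|s0| + 1) / s); first by rewrite divr_ge0 ?addr_ge0// ltW.
have -> : \sum_y p 0 y * noise_var ((`|s0| + 1) / s) y = s0 + (`|s0| + 1) / s * s.
  rewrite /s0 /s mulr_sumr -big_split; apply: eq_bigr => y _ /=.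
  rewrite mulrCA -mulrDr; congr (_ * _); rewrite /noise_var mulr_sumr -big_split.
  by apply: eq_bigr => j _ /=; rewrite Hfun_boosted_form -/s0 -/s; ring.
rewrite divfK ?gt_eqF//; have := ler_norm (- s0); rewrite normrN; lra.
Qed.

End Noise.

(** * Limits of row vectors along a filter *)

Section CoordLimits.
Variables (K : realType) (d : nat) (T : Type) (F : set_system T).
Context {FF : Filter F}.
Implicit Types (f : T -> 'rV[K]_d) (l : 'rV[K]_d) (A : 'M[K]_d).

Lemma cvg_sumr (I : Type) (r : seq I) (f : I -> T -> K) (l : I -> K) :
  (forall i, f i z @[z --> F] --> l i) ->
  \sum_(i <- r) f i z @[z --> F] --> \sum_(i <- r) l i.
Proof.
move=> fl; elim: r => [|i r IH].
  by rewrite big_nil; under eq_fun do rewrite big_nil; exact: cvg_cst.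
by rewrite big_cons; under eq_fun do rewrite big_cons; exact: cvgD.
Qed.

Definition coord_cvg f l := forall i, f z 0 i @[z --> F] --> l 0 i.

Lemma coord_cvgD f g l m : coord_cvg f l -> coord_cvg g m ->
  coord_cvg (fun z => f z + g z) (l + m).
Proof. by move=> fl gm i; rewrite mxE; under eq_fun do rewrite mxE; exact: cvgD. Qed.

Lemma coord_cvgB f g l m : coord_cvg f l -> coord_cvg g m ->
  coord_cvg (fun z => f z - g z) (l - m).
Proof.
move=> fl gm i; rewrite !mxE; under eq_fun do rewrite !mxE; exact: cvgB.
Qed.

Lemma coord_cvg_cst l : coord_cvg (fun=> l) l.
Proof. by move=> i; exact: cvg_cst. Qed.

Lemma coord_cvgZ (s : T -> K) (a : K) f l : s z @[z --> F] --> a -> coord_cvg f l ->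
  coord_cvg (fun z => s z *: f z) (a *: l).
Proof. by move=> sa fl i; rewrite mxE; under eq_fun do rewrite mxE; exact: cvgM. Qed.

Lemma cvg_coord f l : f z @[z --> F] --> l -> coord_cvg f l.
Proof.
move=> fl i; apply: (cvg_comp _ (fun w : 'rV[K]_d => w 0 i) fl).
exact: coord_continuous.
Qed.

Lemma coord_cvg_cvg f l : coord_cvg f l -> f z @[z --> F] --> l.
Proof.
move=> fl; apply/cvgrPdist_le => e e0.
have H i : \forall z \near F, `|l 0 i - f z 0 i| <= e.
  by have /cvgrPdist_le := fl i; apply.
near=> z; apply: row_norm_le => [|i]; first exact: ltW.
by rewrite !mxE; move: i; near: z; exact: (@filter_forall _ _ _ F FF).
Unshelve. all: by end_near. Qed.

Lemma Hfun_cvg A f l : coord_cvg f l -> Hfun A (f z) @[z --> F] --> Hfun A l.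
Proof.
move=> fl; apply: cvg_sumr => i; apply: cvgM; first exact: fl.
by apply: cvg_sumr => j; apply: cvgM; [exact: cvg_cst|exact: fl].
Qed.

Lemma coord_cvg_bound f l : coord_cvg f l -> \forall z \near F, `|f z| <= `|l| + 1.
Proof.
move=> /coord_cvg_cvg fl; near=> z.
have -> : f z = l - (l - f z) by rewrite opprB addrC subrK.
apply: (le_trans (ler_normB _ _)); rewrite lerD2l.
by near: z; move/cvgrPdist_le : fl => /(_ 1 ltr01).
Unshelve. all: by end_near. Qed.

End CoordLimits.

Lemma sum_norm_le (K : realType) (V : normedModType K) (I : finType)
    (k : I -> K) (f : I -> V) C :
  (forall i, 0 <= k i) -> \sum_i k i = 1 -> (forall i, `|f i| <= C) ->
  `|\sum_i k i *: f i| <= C.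
Proof.
move=> k_ge0 k_sum fC; rewrite (le_trans (ler_norm_sum _ _ _))//.
rewrite -[C]mul1r -k_sum mulr_suml; apply: ler_sum => i _.
by rewrite normrZ ger0_norm// ler_wpM2l.
Qed.

(** * The corrected process *)

Section Correctors.
Variables (K : realType) (d : nat) (R : 'M[K]_d) (p : 'rV[K]_d).
Implicit Types (v w u s : 'rV[K]_d).

(** S_n + corrector(S_n, Y_n) has mean increment pi(V_n) up to O(1/n): the corrector
    cancels the dependence of the next step on the current vertex. *)
Definition corrector s y : 'rV[K]_d := row y (invmx (fundmx R p s)) - delta_mx 0 y.

(** The increment of the corrected process in a step from y to j, at time 1 / t and
    occupation vector v.  The kernel is homogeneous of degree 0, so only
    the direction v + t e_j of the new counts matters. *)
Definition corr_incr y j v (t : K) : 'rV[K]_d :=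
  delta_mx 0 j + corrector (v + t *: delta_mx 0 j) j - corrector v y.

Hypotheses (R_sym : R^T = R) (R_ge0 : forall i j, 0 <= R i j)
  (p_critical : critical R p) (p_interior : forall i, 0 < p 0 i).
Hypothesis (Q_unit : fundmx R p p \in unitmx).

Section OneCopy.
Variables (T : Type) (F : set_system T).
Context {FF : Filter F}.
Variables (v : T -> 'rV[K]_d) (t : T -> K).
Hypotheses (vp : v z @[z --> F] --> p) (t0 : t z @[z --> F] --> 0).

Lemma shift_cvg j : v z + t z *: (delta_mx 0 j : 'rV[K]_d) @[z --> F] --> p.
Proof.
apply: coord_cvg_cvg; rewrite -[X in coord_cvg _ _ X]addr0.
apply: coord_cvgD; first exact: cvg_coord.
rewrite -[X in coord_cvg _ _ X](scale0r (delta_mx 0 j)).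
by apply: coord_cvgZ => //; exact: coord_cvg_cst.
Qed.

Lemma corrector_cvg (w : T -> 'rV[K]_d) y : w z @[z --> F] --> p ->
  coord_cvg F (fun z => corrector (w z) y) (corrector p y).
Proof.
move=> wp i; rewrite !mxE; under eq_fun do rewrite !mxE; apply: cvgB; last exact: cvg_cst.
have L := loclip_cvg (loclip_poisson p_critical p_interior Q_unit y i).
exact: (cvg_comp _ (fun s => invmx (fundmx R p s) y i) wp L).
Qed.

Lemma kern_cvg y j : kern R (v z) y j @[z --> F] --> kern R p y j.
Proof.
have L := loclip_cvg (loclip_kern p_critical p_interior y j).
exact: (cvg_comp _ (fun s => kern R s y j) vp L).
Qed.

Lemma corr_incr_cvg y j : coord_cvg F (fun z => corr_incr y j (v z) (t z)) (noise R p y j).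
Proof.
have -> : noise R p y j = delta_mx 0 j + corrector p j - corrector p y.
  by apply/rowP => i; rewrite !mxE; ring.
apply: coord_cvgB; last exact: corrector_cvg.
by apply: coord_cvgD; [exact: coord_cvg_cst|apply: corrector_cvg; exact: shift_cvg].
Qed.

Lemma near_v_regular : \forall z \near F, regular R p (v z).
Proof. exact: vp (near_regular R_sym p_critical p_interior Q_unit). Qed.

Lemma kern_regular u y : regular R p u ->
  (forall j, 0 <= kern R u y j) /\ \sum_j kern R u y j = 1.
Proof.
move=> [u0 N0 _ _]; split; last by rewrite kern_sum// gt_eqF.
by move=> j; rewrite kern_ge0// => i; rewrite ltW.
Qed.

Lemma corrector_shift_bound j : exists2 C, 0 < C & \forall z \near F,
  `|corrector (v z + t z *: delta_mx 0 j) j - corrector (v z) j| <= C * `|t z|.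
Proof.
have LC i := loclip_poisson p_critical p_interior Q_unit j i.
pose C i := sval (cid (LC i)).
have CP i : \forall x \near (p, p), `|invmx (fundmx R p x.1) j i -
    invmx (fundmx R p x.2) j i| <= C i * `|x.1 - x.2| := svalP (cid (LC i)).
exists (\sum_i `|C i| + 1); first by rewrite ltr_pwDr// sumr_ge0.
have pp : (v z + t z *: (delta_mx 0 j : 'rV[K]_d), v z) @[z --> F] --> (p, p).
  exact: (cvg_pair (shift_cvg j) vp).
have H i : \forall z \near F,
    `|invmx (fundmx R p (v z + t z *: delta_mx 0 j)) j i -
    invmx (fundmx R p (v z)) j i| <= C i * `|v z + t z *: delta_mx 0 j - v z|.
  exact: pp _ (CP i).
near=> z.
have Hz : forall i, `|invmx (fundmx R p (v z + t z *: delta_mx 0 j)) j i -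
    invmx (fundmx R p (v z)) j i| <= C i * `|v z + t z *: delta_mx 0 j - v z|.
  by near: z; exact: (@filter_forall _ _ _ F FF).
apply: row_norm_le => [|i]; first by rewrite mulr_ge0// addr_ge0// sumr_ge0.
rewrite [X in `|X|](_ : _ = invmx (fundmx R p (v z + t z *: delta_mx 0 j)) j i -
    invmx (fundmx R p (v z)) j i); last by rewrite !mxE; ring.
apply: (le_trans (Hz i)); rewrite [v z + _]addrC addrK.
have dn : `|t z *: (delta_mx 0 j : 'rV[K]_d)| <= `|t z|.
  rewrite normrZ ler_piMr//; apply: row_norm_le => // k.
  by rewrite mxE eqxx /=; case: (k == j); rewrite ?normr1 ?normr0.
apply: (le_trans (ler_wpM2r (normr_ge0 _) (ler_norm (C i)))).
rewrite ler_pM// (bigD1 i)//= -addrA lerDl addr_ge0// sumr_ge0//.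
Unshelve. all: by end_near. Qed.

(** If the corrector were evaluated at v after the step, the mean would be exactly
    pi(v), by the Poisson equation; the corrector is Lipschitz in v. *)
Lemma mean_corr_incr y : exists2 C, 0 < C & \forall z \near F,
  `|\sum_j kern R (v z) y j *: corr_incr y j (v z) (t z) - pimap R (v z)| <= C * `|t z|.
Proof.
pose C j := sval (cid2 (corrector_shift_bound j)).
have C_gt0 j : 0 < C j by rewrite /C; case: cid2.
have CP j : \forall z \near F,
    `|corrector (v z + t z *: delta_mx 0 j) j - corrector (v z) j| <= C j * `|t z|.
  by rewrite /C; case: cid2.
exists (\sum_j C j + 1); first by rewrite ltr_pwDr// sumr_ge0// => j _; rewrite ltW.
near=> z.
have Hz : forall j, `|corrector (v z + t z *: delta_mx 0 j) j - corrector (v z) j| <= C j * `|t z|.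
  by near: z; exact: (@filter_forall _ _ _ F FF).
have reg : regular R p (v z) by near: z; exact: near_v_regular.
have [k_ge0 k_sum] := kern_regular y reg; have [_ N0 H0 Qz] := reg.
rewrite [X in `|X|](_ : _ = \sum_j kern R (v z) y j *:
    (corrector (v z + t z *: delta_mx 0 j) j - corrector (v z) j)).
  apply: sum_norm_le => // j; apply: (le_trans (Hz j)); rewrite ler_wpM2r//.
  by rewrite (bigD1 j)//= -addrA lerDl addr_ge0// sumr_ge0// => i _; rewrite ltW.
have E : \sum_j kern R (v z) y j *: (delta_mx 0 j + corrector (v z) j) =
    corrector (v z) y + pimap R (v z).
  apply/rowP => i; rewrite summxE.
  have /matrixP/(_ y i) := poisson_eq R_sym (fun y => lt0r_neq0 (N0 y)) (lt0r_neq0 H0) Qz.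
  rewrite mxE => E; rewrite (eq_bigr (fun j => kernmx R (v z) y j * invmx (fundmx R p (v z)) j i)).
    by rewrite E !mxE eqxx /= eq_sym; ring.
  by move=> j _; rewrite !mxE; ring.
apply/eqP; rewrite subr_eq; apply/eqP.
rewrite (eq_bigr (fun j => kern R (v z) y j *: (delta_mx 0 j + corrector (v z) j) +
   kern R (v z) y j *: (corrector (v z + t z *: delta_mx 0 j) j - corrector (v z) j) -
   kern R (v z) y j *: corrector (v z) y)).
  rewrite !big_split /= sumrN -scaler_suml k_sum scale1r E.
  by rewrite -[corrector _ _ + _ + _]addrA addrAC subrr add0r addrC.
move=> j _; rewrite -!scalerDr -scalerN -scalerDr; congr (_ *: _).
by rewrite /corr_incr; apply/rowP => i; rewrite !mxE; ring.
Unshelve. all: by end_near. Qed.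

End OneCopy.
End Correctors.

(** * Two independent copies *)

Section PairSums.
Variables (K : comNzRingType) (I : finType).
Implicit Types (k l f : I -> K).

Lemma pair_sum_mul k l : (\sum_i k i) * (\sum_j l j) =
  \sum_(ij : I * I) k ij.1 * l ij.2.
Proof.
by rewrite big_distrlr /= pair_bigA.
Qed.

Lemma pair_sum_fst k l f : \sum_j l j = 1 ->
  \sum_(ij : I * I) k ij.1 * l ij.2 * f ij.1 = \sum_i k i * f i.
Proof.
move=> l1; rewrite -(pair_bigA _ (fun i j => k i * l j * f i)) /=.
apply: eq_bigr => i _; rewrite -[RHS]mulr1 -l1 mulr_sumr.
by apply: eq_bigr => j _; ring.
Qed.

Lemma pair_sum_snd k l f : \sum_i k i = 1 ->
  \sum_(ij : I * I) k ij.1 * l ij.2 * f ij.2 = \sum_j l j * f j.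
Proof.
move=> k1; rewrite -(pair_bigA _ (fun i j => k i * l j * f j)) /= exchange_big /=.
apply: eq_bigr => j _; rewrite -[RHS]mul1r -k1 mulr_suml.
by apply: eq_bigr => i _; ring.
Qed.

End PairSums.

Section TwoCopies.
Variables (K : realType) (d : nat) (R : 'M[K]_d) (p : 'rV[K]_d).
Implicit Types (u w s : 'rV[K]_d).
Hypotheses (R_sym : R^T = R) (R_ge0 : forall i j, 0 <= R i j)
  (p_critical : critical R p) (p_interior : forall i, 0 < p 0 i).
Hypothesis (Q_unit : fundmx R p p \in unitmx).
Variable (B : 'M[K]_d).
Hypothesis B_sym : B^T = B.
Local Notation G := (invmx (fundmx R p p)).

Definition noise_energy_at y : K := \sum_j kern R p y j * Hfun B (noise R p y j - p).
Definition mean_noise_energy : K := \sum_y p 0 y * noise_energy_at y.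
(** The conditional energy of the noise depends on the vertex and may even be
    negative; only its mean is positive.  Adding this solution of a Poisson equation,
    divided by n^2, to the Lyapunov function replaces the energy by its mean. *)
Definition noise_corr y : K := \sum_j G y j * noise_energy_at j.

Lemma noise_corr_poisson y : \sum_j kern R p y j * noise_corr j =
  noise_corr y - noise_energy_at y + mean_noise_energy.
Proof.
pose f : 'cV[K]_d := \col_j noise_energy_at j.
have Gf i : (G *m f) i 0 = noise_corr i by rewrite mxE; apply: eq_bigr => j _; rewrite mxE.
have := congr1 (fun M : 'M[K]_d => (M *m f) y 0)
  (poisson_p R_sym p_critical p_interior Q_unit).
rewrite -mulmxA mulmxDl mulmxBl mul1mx => E.
transitivity ((kernmx R p *m (G *m f)) y 0).
  by rewrite mxE; apply: eq_bigr => j _; rewrite Gf mxE.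
rewrite E mxE [X in X + _]mxE Gf; congr (_ + _).
  by rewrite !mxE.
by rewrite mxE; apply: eq_bigr => j _; rewrite !mxE.
Qed.

Definition pairk (u u' : 'rV[K]_d) (y y' : 'I_d) (jj : 'I_d * 'I_d) : K :=
  kern R u y jj.1 * kern R u' y' jj.2.

(** The copies are independent and the noises are centred, so the cross term vanishes
    and the energies add up. *)
Lemma pair_noise_limit y y' :
  \sum_jj pairk p p y y' jj *
    (Hfun B (noise R p y jj.1 - noise R p y' jj.2) + noise_corr jj.1 + noise_corr jj.2)
  - noise_corr y - noise_corr y' = 2 * mean_noise_energy.
Proof.
have k1 y0 : \sum_j kern R p y0 j = 1 by exact: kern_p_sum.
rewrite (eq_bigr (fun jj => pairk p p y y' jj * (Hfun B (noise R p y jj.1 - p) + noise_corr jj.1)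
   + pairk p p y y' jj * (Hfun B (noise R p y' jj.2 - p) + noise_corr jj.2)
   - 2 * (pairk p p y y' jj * Bform B (noise R p y jj.1 - p) (noise R p y' jj.2 - p)))).
  rewrite !big_split /= sumrN -mulr_sumr.
  rewrite (pair_sum_fst (kern R p y) (fun j => Hfun B (noise R p y j - p) + noise_corr j))//.
  rewrite (pair_sum_snd (kern R p y') (fun j => Hfun B (noise R p y' j - p) + noise_corr j))//.
  have -> : \sum_jj pairk p p y y' jj * Bform B (noise R p y jj.1 - p) (noise R p y' jj.2 - p) = 0.
    rewrite -(pair_bigA _ (fun j j' =>
      kern R p y j * kern R p y' j' * Bform B (noise R p y j - p) (noise R p y' j' - p))) /=.
    apply: big1 => j _; under eq_bigr do rewrite -mulrA.
    rewrite -mulr_sumr -Bform_sumr (noise_mean R_sym p_critical p_interior Q_unit).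
    by rewrite /Bform big1 ?mulr0// => i _; rewrite /Nfun big1 ?mulr0// => l _; rewrite mxE mulr0.
  have S y0 : \sum_j kern R p y0 j * (Hfun B (noise R p y0 j - p) + noise_corr j) =
      noise_corr y0 + mean_noise_energy.
    under eq_bigr do rewrite mulrDr.
    by rewrite big_split /= noise_corr_poisson /noise_energy_at; ring.
  by rewrite !S; ring.
move=> jj _.
have -> : noise R p y jj.1 - noise R p y' jj.2 =
    (noise R p y jj.1 - p) + (-1) *: (noise R p y' jj.2 - p).
  by apply/rowP => i; rewrite !mxE; ring.
rewrite Hfun_Bform//; ring.
Qed.

Section AlongFilter.
Variables (T : Type) (F : set_system T).
Context {FF : Filter F}.
Variables (v v' : T -> 'rV[K]_d) (t : T -> K).
Hypotheses (vp : v z @[z --> F] --> p) (v'p : v' z @[z --> F] --> p)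
  (t0 : t z @[z --> F] --> 0).
Variables (y y' : 'I_d).

(** The difference of the corrected processes of the two copies, divided by the time
    1 / r, in terms of the occupation vectors u and u'. *)
Definition gap (u u' : 'rV[K]_d) (r : K) : 'rV[K]_d :=
  (u - u') + r *: (corrector R p u y - corrector R p u' y').

(** The gap x at time n becomes x + gap_incr / (n + 1) at time n + 1. *)
Definition gap_incr (jj : 'I_d * 'I_d) u u' r : 'rV[K]_d :=
  corr_incr R p y jj.1 u r - corr_incr R p y' jj.2 u' r - gap u u' r.

Lemma gap_cvg : coord_cvg F (fun z => gap (v z) (v' z) (t z)) 0.
Proof.
have -> : 0 = (p - p) + 0 *: (corrector R p p y - corrector R p p y').
  by rewrite subrr scale0r addr0.
apply: coord_cvgD; first by apply: coord_cvgB; exact: cvg_coord.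
by apply: coord_cvgZ => //; apply: coord_cvgB; exact: corrector_cvg.
Qed.

Lemma gap_incr_cvg jj : coord_cvg F (fun z => gap_incr jj (v z) (v' z) (t z))
  (noise R p y jj.1 - noise R p y' jj.2).
Proof.
rewrite -[X in coord_cvg _ _ X]subr0; apply: coord_cvgB; last exact: gap_cvg.
by apply: coord_cvgB; exact: corr_incr_cvg.
Qed.

Lemma gap_incr_bound : exists2 C, 0 < C & \forall z \near F,
  forall jj, `|gap_incr jj (v z) (v' z) (t z)| <= C.
Proof.
pose l jj := noise R p y jj.1 - noise R p y' jj.2.
exists (\sum_jj `|l jj| + 1); first by rewrite ltr_pwDr// sumr_ge0.
apply: (@filter_forall _ _ (fun jj z =>
  `|gap_incr jj (v z) (v' z) (t z)| <= \sum_jj `|l jj| + 1) F FF) => jj.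
have cb : \forall z \near F, `|gap_incr jj (v z) (v' z) (t z)| <= `|l jj| + 1.
  exact: coord_cvg_bound (@gap_incr_cvg jj).
apply: filterS cb => z /le_trans; apply.
by rewrite lerD2r (bigD1 jj)//= lerDl sumr_ge0.
Qed.

Lemma second_order_cvg :
  \sum_jj pairk (v z) (v' z) y y' jj *
    (Hfun B (gap_incr jj (v z) (v' z) (t z)) + noise_corr jj.1 + noise_corr jj.2)
  - noise_corr y - noise_corr y' @[z --> F] --> 2 * mean_noise_energy.
Proof.
rewrite -(pair_noise_limit y y').
apply: cvgB; last exact: cvg_cst.
apply: cvgB; last exact: cvg_cst.
apply: cvg_sumr => jj; apply: cvgM.
  by apply: cvgM; exact: kern_cvg.
apply: cvgD; last exact: cvg_cst.
by apply: cvgD; [apply: Hfun_cvg; exact: gap_incr_cvg|exact: cvg_cst].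
Qed.

(** The mean is pi(v) - pi(v') minus the gap, up to O(1/n); strict differentiability
    turns it into the derivative of pi - I at the gap, with an error that is small
    compared with the gap. *)
Lemma mean_gap_incr e : 0 < e -> exists2 C, 0 < C & \forall z \near F,
  `|\sum_jj pairk (v z) (v' z) y y' jj *: gap_incr jj (v z) (v' z) (t z)
    - dpi R p (gap (v z) (v' z) (t z))| <=
  e * `|gap (v z) (v' z) (t z)| + C * `|t z|.
Proof.
move=> e0.
have [C1 C1_gt0 mz] := mean_corr_incr R_sym R_ge0 p_critical p_interior Q_unit vp t0 y.
have [C2 C2_gt0 mz'] := mean_corr_incr R_sym R_ge0 p_critical p_interior Q_unit v'p t0 y'.
have [C3 C3_gt0 dpiC] := @linear_bound _ _ _ (dpi R p).
pose c := corrector R p p y - corrector R p p y'.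
have cc : coord_cvg F (fun z => corrector R p (v z) y - corrector R p (v' z) y') c.
  by apply: coord_cvgB; exact: corrector_cvg.
have cb : \forall z \near F, `|corrector R p (v z) y - corrector R p (v' z) y'| <= `|c| + 1.
  exact: coord_cvg_bound cc.
set C4 := `|c| + 1 in cb; have C4_gt0 : 0 < C4 by rewrite ltr_pwDr.
have vv'p : (v z, v' z) @[z --> F] --> (p, p) by exact: (cvg_pair vp v'p).
have strict : \forall z \near F, `|pimap R (v z) - pimap R (v' z) -
   (v z - v' z + dpi R p (v z - v' z))| <= e * `|v z - v' z|.
  exact: vv'p _ (pimap_strict R_sym p_critical p_interior e0).
have regv : \forall z \near F, regular R p (v z) by exact: near_v_regular vp.
have regv' : \forall z \near F, regular R p (v' z) by exact: near_v_regular v'p.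
exists (C1 + C2 + e * C4 + C4 + C3 * C4).
  have e4 := mulr_gt0 e0 C4_gt0; have e34 := mulr_gt0 C3_gt0 C4_gt0.
  move: (C1) (C2) (C4) (e * C4) (C3 * C4) C1_gt0 C2_gt0 C4_gt0 e4 e34 => c1 c2 c4 c5 c6 *. lra.
near=> z.
have regz : regular R p (v z) by near: z.
have regz' : regular R p (v' z) by near: z.
have [_ k1] := kern_regular R_ge0 y regz.
have [_ k1'] := kern_regular R_ge0 y' regz'.
have W_le : `|\sum_j kern R (v z) y j *: corr_incr R p y j (v z) (t z) - pimap R (v z)|
  <= C1 * `|t z| by near: z.
have W'_le : `|\sum_j kern R (v' z) y' j *: corr_incr R p y' j (v' z) (t z) - pimap R (v' z)|
  <= C2 * `|t z| by near: z.
have w_le0 : `|corrector R p (v z) y - corrector R p (v' z) y'| <= C4 by near: z.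
have S_le0 : `|pimap R (v z) - pimap R (v' z) -
   (v z - v' z + dpi R p (v z - v' z))| <= e * `|v z - v' z| by near: z.
set x := gap _ _ _; set D := v z - v' z in S_le0 *.
set w := corrector R p (v z) y - corrector R p (v' z) y'.
have xE : x = D + t z *: w by [].
set W := \sum_j kern R (v z) y j *: corr_incr R p y j (v z) (t z) - pimap R (v z).
set W' := \sum_j kern R (v' z) y' j *: corr_incr R p y' j (v' z) (t z) - pimap R (v' z).
rewrite -/W in W_le; rewrite -/W' in W'_le.
have w_le : `|t z *: w| <= C4 * `|t z|.
  by rewrite normrZ mulrC ler_wpM2r.
have D_le : `|D| <= `|x| + C4 * `|t z|.
  have -> : D = x - t z *: w by rewrite xE addrK.
  by rewrite (le_trans (ler_normB _ _))// lerD2l.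
set S := pimap R (v z) - pimap R (v' z) - (D + dpi R p D).
have S_le : `|S| <= e * `|x| + e * C4 * `|t z|.
  apply: (le_trans S_le0).
  by rewrite -mulrA -mulrDr ler_pM2l.
have -> : \sum_jj pairk (v z) (v' z) y y' jj *: gap_incr jj (v z) (v' z) (t z) =
    W - W' + (pimap R (v z) - pimap R (v' z)) - x.
  apply/rowP => i; rewrite summxE.
  rewrite (eq_bigr (fun jj => pairk (v z) (v' z) y y' jj * corr_incr R p y jj.1 (v z) (t z) 0 i
    - pairk (v z) (v' z) y y' jj * corr_incr R p y' jj.2 (v' z) (t z) 0 i
    - kern R (v z) y jj.1 * kern R (v' z) y' jj.2 * x 0 i)); last first.
    by move=> jj _; rewrite mxE [X in _ * X]mxE [X in _ * (X + _)]mxE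
      [X in _ * (_ + X + _)]mxE [X in _ * (_ + X)]mxE /pairk -/x; ring.
  rewrite !big_split /= !sumrN -mulr_suml -pair_sum_mul k1 k1' !mul1r.
  rewrite (pair_sum_fst (kern R (v z) y) (fun j => corr_incr R p y j (v z) (t z) 0 i))//.
  rewrite (pair_sum_snd (kern R (v' z) y') (fun j => corr_incr R p y' j (v' z) (t z) 0 i))//.
  have WE j0 : W 0 j0 =
      \sum_j kern R (v z) y j * corr_incr R p y j (v z) (t z) 0 j0 - pimap R (v z) 0 j0.
    by rewrite !mxE summxE; congr (_ - _); apply: eq_bigr => j _; rewrite mxE.
  have W'E j0 : W' 0 j0 =
      \sum_j kern R (v' z) y' j * corr_incr R p y' j (v' z) (t z) 0 j0 - pimap R (v' z) 0 j0.
    by rewrite !mxE summxE; congr (_ - _); apply: eq_bigr => j _; rewrite mxE.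
  have mE (b1 b2 b3 b4 b5 : 'rV[K]_d) :
    (b1 - b2 + (b3 - b4) - b5) 0 i = b1 0 i - b2 0 i + (b3 0 i - b4 0 i) - b5 0 i.
    by rewrite !mxE.
  by rewrite mE WE W'E; ring.
have -> : W - W' + (pimap R (v z) - pimap R (v' z)) - x - dpi R p x =
    W - W' + S - t z *: w - dpi R p (t z *: w).
  rewrite /S xE; have -> : dpi R p (D + t z *: w) = dpi R p D + dpi R p (t z *: w).
    exact: raddfD.
  have gE (b1 b2 b3 b4 b5 b6 : 'rV[K]_d) :
    b1 + b2 - (b3 + b4) - (b5 + b6) = b1 + (b2 - (b3 + b5)) - b4 - b6.
    by apply/rowP => i; rewrite !mxE; ring.
  exact: gE.
have T1 := ler_normB (W - W' + S - t z *: w) (dpi R p (t z *: w)).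
have T2 := ler_normB (W - W' + S) (t z *: w).
have T3 := ler_normD (W - W') S.
have T4 := ler_normB W W'.
have T5 : `|dpi R p (t z *: w)| <= C3 * C4 * `|t z|.
  by rewrite -mulrA (le_trans (dpiC _))// ler_pM2l.
have U := le_trans T2 (lerD (le_trans T3 (lerD (le_trans T4 (lerD W_le W'_le)) S_le)) w_le).
apply: (le_trans (le_trans T1 (lerD U T5))); rewrite le_eqVlt; apply/orP; left.
by apply/eqP; ring.
Unshelve. all: by end_near. Qed.

End AlongFilter.
End TwoCopies.

(** * The drift of the Lyapunov function *)

Section Lyapunov.
Variables (K : realType) (d : nat) (R : 'M[K]_d) (p : 'rV[K]_d).
Implicit Types (u w s : 'rV[K]_d).
Hypotheses (R_sym : R^T = R) (R_ge0 : forall i j, 0 <= R i j)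
  (p_critical : critical R p) (p_interior : forall i, 0 < p 0 i).
Hypothesis (Q_unit : fundmx R p p \in unitmx).
Variables (B : 'M[K]_d) (m : K).
Hypotheses (B_sym : B^T = B) (m_gt0 : 0 < m)
  (B_coercive : forall w, tangent w -> m * `|w| ^+ 2 <= Bform B w (dpi R p w))
  (mean_noise_gt0 : 0 < mean_noise_energy R p B).
Local Notation nb := (mean_noise_energy R p B).
Local Notation nc := (noise_corr R p B).

Definition time (z : nat * ('rV[K]_d * 'rV[K]_d)) : K := z.1.+1%:R.

(** Late times and occupation vectors close to p.  The pair (n, (v, v')) stands for
    the time n + 1, which is never 0. *)
Definition late_near : set_system (nat * ('rV[K]_d * 'rV[K]_d)) := filter_prod \oo (nbhs (p, p)).
Local Instance late_near_filter : Filter late_near. Proof. exact: filter_prod_filter. Qed.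

Lemma late_near_fst : z.2.1 @[z --> late_near] --> p.
Proof.
have H : z.2 @[z --> late_near] --> nbhs (p, p) by exact: cvg_snd.
exact: (cvg_comp _ fst H cvg_fst).
Qed.

Lemma late_near_snd : z.2.2 @[z --> late_near] --> p.
Proof.
have H : z.2 @[z --> late_near] --> nbhs (p, p) by exact: cvg_snd.
exact: (cvg_comp _ snd H cvg_snd).
Qed.

Lemma late_near_time : (time z)^-1 @[z --> late_near] --> 0.
Proof.
have H : z.1 @[z --> late_near] --> \oo by exact: cvg_fst.
exact: (cvg_comp _ (@harmonic K) H cvg_harmonic).
Qed.

Lemma corrector_sum u y : regular R p u -> \sum_i corrector R p u y 0 i = 0.
Proof.
move=> [_ N0 _ Qu]; under eq_bigr do rewrite !mxE.
rewrite sumrB (poisson_row_sum (critical_sum p_critical) (fun i => lt0r_neq0 (N0 i)) Qu).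
rewrite (bigD1 y)//= !eqxx big1 ?addr0 ?subrr// => i /negbTE iy.
by rewrite iy.
Qed.

Section Start.
Variables (y y' : 'I_d).
Local Notation x := (fun z => gap R p y y' z.2.1 z.2.2 (time z)^-1).
Local Notation g := (fun jj z => gap_incr R p y y' jj z.2.1 z.2.2 (time z)^-1).
Local Notation k2 := (fun z => pairk R z.2.1 z.2.2 y y').

(** The increment of [lyapunov] when the two copies move to jj ([lyapunov_step]). *)
Definition lyapunov_incr jj z : K :=
  2 * Bform B (x z) (g jj z) / (time z + 1)
  + (Hfun B (g jj z) + nc jj.1 + nc jj.2) / (time z + 1) ^+ 2
  - (nc y + nc y') / time z ^+ 2 + nb / 4 / (time z + 1) - nb / 4 / time z.

Lemma time_ge1 z : 1 <= time z.
Proof. by rewrite /time ler1n. Qed.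

Lemma inv_time (n : K) : 1 <= n ->
  [/\ n^-1 * (n + 1)^-1 <= 2 * (n + 1)^-1 ^+ 2,
      n^-1 ^+ 2 - (n + 1)^-1 ^+ 2 <= 3 * n^-1 * (n + 1)^-1 ^+ 2 &
      n^-1 ^+ 2 <= 4 * (n + 1)^-1 ^+ 2].
Proof.
move=> n1; have n0 : 0 < n by lra. have N0 : 0 < n + 1 by lra.
have n2 : n^-1 <= 2 * (n + 1)^-1.
  rewrite -subr_ge0 (_ : _ - _ = (n - 1) / (n * (n + 1))); last by field; lra.
  by rewrite divr_ge0 ?subr_ge0// mulr_ge0// ltW.
have N0' : 0 < (n + 1)^-1 by rewrite invr_gt0.
have n0' : 0 < n^-1 by rewrite invr_gt0.
split; [by nra| |by nra].
rewrite -subr_ge0 (_ : _ - _ = (n - 1) / (n ^+ 2 * (n + 1) ^+ 2)); last by field; lra.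
by rewrite divr_ge0 ?subr_ge0// mulr_ge0// sqr_ge0.
Qed.

(** The drift of the form, the noise energy e2 and the averaging terms, added up.  The
    error of b, the term with H and the terms with s / 4 cost at most s / 4, s / 4 and
    s / 2 of the energy 3 / 2 s, in units of (n + 1)^-2. *)
Lemma drift_arith (n X b e2 H s c : K) : 1 <= n -> 0 <= X -> 0 < s ->
  m / 2 * X ^+ 2 - s / 16 * n^-1 <= b -> 3 / 2 * s <= e2 -> `|H| * n^-1 <= s / 12 ->
  c <= m -> c <= s / 2 ->
  c * (X ^+ 2 / (n + 1) + (n + 1)^-1 ^+ 2) <=
  2 * b / (n + 1) + (e2 + H) / (n + 1) ^+ 2 - H / n ^+ 2 + s / 4 / (n + 1) - s / 4 / n.
Proof.
move=> n1 X0 s0 bP e2P HP cm cs.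
have [F1 F2 F3] := inv_time n1.
have n0 : 0 < n by lra. have N0 : 0 < n + 1 by lra.
have E : s / 4 / (n + 1) - s / 4 / n = - (s / 4) * (n^-1 * (n + 1)^-1) by field; lra.
rewrite -addrA E -!exprVn.
have at_le : (n + 1)^-1 <= n^-1 by rewrite lef_pV2 ?posrE//; lra.
set t := n^-1 in bP HP F1 F2 F3 at_le *; set a := (n + 1)^-1 in F1 F2 F3 at_le *.
have a0 : 0 < a by rewrite invr_gt0.
have t0 : 0 < t by rewrite invr_gt0.
have a2 : 0 < a ^+ 2 by rewrite exprn_gt0.
have HH : H * (t ^+ 2 - a ^+ 2) <= s / 4 * a ^+ 2.
  have ta : 0 <= t ^+ 2 - a ^+ 2.
    by rewrite subr_ge0 ler_sqr// nnegrE ltW.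
  have := ler_wpM2r ta (ler_norm H); have := ler_wpM2l (normr_ge0 H) F2.
  have : `|H| * (3 * t * a ^+ 2) = `|H| * t * (3 * a ^+ 2) by ring.
  have : `|H| * t * (3 * a ^+ 2) <= s / 12 * (3 * a ^+ 2).
    by rewrite ler_wpM2r// mulr_ge0// ltW.
  lra.
have bb : (m * X ^+ 2 - s / 8 * t) * a <= 2 * b * a by rewrite ler_wpM2r ?(ltW a0)//; lra.
have sF1 : s * (t * a) <= s * (2 * a ^+ 2) by rewrite ler_wpM2l// ltW.
have ee : 3 / 2 * s * a ^+ 2 <= e2 * a ^+ 2 by rewrite ler_wpM2r// ltW.
have X2a : 0 <= X ^+ 2 * a by rewrite mulr_ge0 ?sqr_ge0// ltW.
have c1 : c * (X ^+ 2 * a) <= m * (X ^+ 2 * a) by rewrite ler_wpM2r.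
have c2 : c * a ^+ 2 <= s / 2 * a ^+ 2 by rewrite ler_wpM2r// ltW.
lra.
Qed.

Lemma perturbed_le (b1 b2 q r : K) : m * q <= b1 -> `|b2| <= m / 2 * q + r ->
  m / 2 * q - r <= b1 + b2.
Proof. by have := ler_norm (- b2); rewrite normrN; lra. Qed.

Lemma lyapunov_incr_mean z : \sum_j kern R z.2.1 y j = 1 -> \sum_j kern R z.2.2 y' j = 1 ->
  \sum_jj k2 z jj * lyapunov_incr jj z =
  2 * Bform B (x z) (\sum_jj k2 z jj *: g jj z) / (time z + 1)
  + ((\sum_jj k2 z jj * (Hfun B (g jj z) + nc jj.1 + nc jj.2) - nc y - nc y')
       + (nc y + nc y')) / (time z + 1) ^+ 2
  - (nc y + nc y') / time z ^+ 2 + nb / 4 / (time z + 1) - nb / 4 / time z.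
Proof.
move=> k1 k1'.
have k2_sum : \sum_jj k2 z jj = 1 by rewrite -pair_sum_mul k1 k1' mulr1.
rewrite (Bform_sumr _ _ (fun jj => k2 z jj) (fun jj => g jj z)).
set cst := - (nc y + nc y') / time z ^+ 2 + nb / 4 / (time z + 1) - nb / 4 / time z.
rewrite (eq_bigr (fun jj => 2 / (time z + 1) * (k2 z jj * Bform B (x z) (g jj z)) +
   (k2 z jj * (Hfun B (g jj z) + nc jj.1 + nc jj.2)) * ((time z + 1) ^+ 2)^-1 +
   k2 z jj * cst)).
  by rewrite !big_split /= -mulr_sumr -!mulr_suml k2_sum /cst; ring.
by move=> jj _; rewrite /lyapunov_incr /cst; ring.
Qed.

Lemma lyapunov_drift c : 0 < c -> c <= m -> c <= nb / 2 -> exists2 C, 0 < C &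
  \forall z \near late_near, [/\ tangent (z.2.1 - z.2.2) ->
     c * (`|x z| ^+ 2 / (time z + 1) + (time z + 1)^-1 ^+ 2) <= \sum_jj k2 z jj * lyapunov_incr jj z,
   forall jj, `|lyapunov_incr jj z| <= C * (`|x z| / (time z + 1) + (time z + 1)^-1 ^+ 2)
   & `|x z| <= 1].
Proof.
move=> c0 cm cs.
have [Cb Cb0 CbP] := Bform_bound B.
have [Ch Ch0 ChP] := Hfun_bound B.
have [Cg Cg0 CgP] := gap_incr_bound p_critical p_interior Q_unit
  late_near_fst late_near_snd late_near_time y y'.
(* with this relative error at most half of the coercive drift is lost *)
have e0 : 0 < m / (2 * Cb) by rewrite divr_gt0 ?mulr_gt0.
have [C C0 CP] := mean_gap_incr R_sym R_ge0 p_critical p_interior Q_unit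
  late_near_fst late_near_snd late_near_time y y' e0.
have e2 : \forall z \near late_near, 3 / 2 * nb <=
   \sum_jj k2 z jj * (Hfun B (g jj z) + nc jj.1 + nc jj.2) - nc y - nc y'.
  have L : \sum_jj k2 z jj * (Hfun B (g jj z) + nc jj.1 + nc jj.2) - nc y - nc y'
      @[z --> late_near] --> 2 * nb.
    exact: (second_order_cvg R_sym p_critical p_interior Q_unit B_sym
      late_near_fst late_near_snd late_near_time).
  by apply: (cvgr_ge _ L); move: mean_noise_gt0; lra.
have x0 : `|x z| @[z --> late_near] --> 0.
  rewrite -(@normr0 _ 'rV[K]_d); apply: cvg_norm; apply: coord_cvg_cvg.
  exact: (gap_cvg p_critical p_interior Q_unit late_near_fst late_near_snd late_near_time).
have x1 : \forall z \near late_near, `|x z| <= 1 by apply: (cvgr_le _ x0); lra.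
have walk_gap : \forall z \near late_near, `|x z| <= nb / (16 * Cb * C).
  by apply: (cvgr_le _ x0); rewrite divr_gt0 ?mulr_gt0.
set H := nc y + nc y'.
have Ht : \forall z \near late_near, `|H| * (time z)^-1 <= nb / 12.
  have L : `|H| * (time z)^-1 @[z --> late_near] --> `|H| * 0.
    by apply: cvgM; [exact: cvg_cst|exact: late_near_time].
  by apply: (cvgr_le _ L); rewrite mulr0 divr_gt0.
have regv : \forall z \near late_near, regular R p z.2.1 by exact: near_v_regular late_near_fst.
have regv' : \forall z \near late_near, regular R p z.2.2 by exact: near_v_regular late_near_snd.
pose Nm := \sum_j `|nc j|.
have NmP j : `|nc j| <= Nm by rewrite /Nm (bigD1 j)//= lerDl sumr_ge0.
have Nm0 : 0 <= Nm by rewrite sumr_ge0.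
exists (2 * Cb * Cg + Ch * Cg ^+ 2 + 10 * Nm + nb).
  by rewrite ltr_wpDl// addr_ge0 ?mulr_ge0// addr_ge0// mulr_ge0 ?sqr_ge0 ?ltW// mulr_gt0.
near=> z; split; last by near: z.
- move=> tan.
  have regz : regular R p z.2.1 by near: z.
  have regz' : regular R p z.2.2 by near: z.
  have [_ k1] := kern_regular R_ge0 y regz.
  have [_ k1'] := kern_regular R_ge0 y' regz'.
  rewrite lyapunov_incr_mean//.
  apply: drift_arith => //; first exact: time_ge1.
  + have xt : tangent (x z).
      rewrite /tangent /=; under eq_bigr do rewrite mxE [X in _ + X]mxE [X in _ * X]mxE
        [X in _ * (_ + X)]mxE.
      rewrite big_split -mulr_sumr big_split sumrN /=.
      by rewrite (corrector_sum _ regz) (corrector_sum _ regz') subrr mulr0 addr0.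
    have SP : `|\sum_jj k2 z jj *: g jj z - dpi R p (x z)| <=
        m / (2 * Cb) * `|x z| + C * `|(time z)^-1| by near: z.
    have := B_coercive xt; set S := \sum_jj _ in SP * => BxP.
    have -> : S = dpi R p (x z) + (S - dpi R p (x z)) by rewrite addrC subrK.
    rewrite BformDr.
    have E1 := CbP (x z) (S - dpi R p (x z)).
    have xs' : `|x z| <= nb / (16 * Cb * C) by near: z.
    have t0 : 0 < (time z)^-1 by rewrite invr_gt0 (lt_le_trans ltr01)// time_ge1.
    rewrite gtr0_norm// in SP.
    have E2 : Cb * `|x z| * `|S - dpi R p (x z)| <=
        m / 2 * `|x z| ^+ 2 + nb / 16 * (time z)^-1.
      apply: (@le_trans _ _ (Cb * `|x z| * (m / (2 * Cb) * `|x z| + C * (time z)^-1))).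
        by rewrite ler_wpM2l// mulr_ge0// ltW.
      rewrite mulrDr lerD//.
        rewrite le_eqVlt; apply/orP; left; apply/eqP; field; exact: lt0r_neq0.
      rewrite mulrA ler_wpM2r ?(ltW t0)//.
      move: xs'; rewrite ler_pdivlMr ?mulr_gt0//.
      by move=> xs'; rewrite ler_pdivlMr//; move: xs'; congr (_ <= _); ring.
    exact: perturbed_le BxP (le_trans E1 E2).
  + by near: z.
  + by near: z.
- move=> jj.
  have n1 := time_ge1 z.
  have [F1 _ F3] := inv_time n1.
  have gz : `|g jj z| <= Cg by move: jj; near: z.
  have xg := CbP (x z) (g jj z); have hg := ChP (g jj z).
  rewrite /lyapunov_incr -!exprVn.
  have E : nb / 4 / (time z + 1) - nb / 4 / time z =
      - (nb / 4 * ((time z)^-1 * (time z + 1)^-1)) by field; lra.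
  rewrite -[_ + nb / 4 / _ - _]addrA E.
  have a0 : 0 < (time z + 1)^-1 by rewrite invr_gt0; lra.
  have t0 : 0 < (time z)^-1 by rewrite invr_gt0; lra.
  move: F1 F3 a0 t0; set t := (time z)^-1; set a := (time z + 1)^-1 => F1 F3 a0 t0.
  have a2 : 0 <= a ^+ 2 by rewrite sqr_ge0.
  have b1 : `|2 * Bform B (x z) (g jj z) * a| <= 2 * Cb * Cg * (`|x z| * a).
    rewrite normrM (gtr0_norm a0) normrM (gtr0_norm (ltr0n _ 2)).
    rewrite -mulrA [leRHS](_ : _ = 2 * (Cb * `|x z| * Cg * a)); last by ring.
    rewrite ler_pM2l// ler_pM2r// (le_trans xg)// ler_wpM2l// mulr_ge0// ltW//.
  have b2 : `|(Hfun B (g jj z) + nc jj.1 + nc jj.2) * a ^+ 2| <=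
      (Ch * Cg ^+ 2 + Nm + Nm) * a ^+ 2.
    rewrite normrM (ger0_norm a2) ler_wpM2r//.
    rewrite (le_trans (ler_normD _ _))// lerD// (le_trans (ler_normD _ _))// lerD//.
    rewrite (le_trans hg)// ler_wpM2l ?(ltW Ch0)// ler_sqr ?nnegrE//; exact: ltW.
  have b3 : `|(nc y + nc y') * t ^+ 2| <= (Nm + Nm) * (4 * a ^+ 2).
    rewrite normrM ler_pM// ?(le_trans (ler_normD _ _)) ?lerD//.
    by rewrite ger0_norm// sqr_ge0.
  have b4 : `|nb / 4 * (t * a)| <= nb / 4 * (2 * a ^+ 2).
    have n4 : 0 <= nb / 4 by rewrite divr_ge0// ltW.
    by rewrite ger0_norm ?ler_wpM2l// mulr_ge0// mulr_ge0// ltW.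
  apply: (le_trans (ler_normB _ _)); apply: (le_trans (lerD (le_trans (ler_normB _ _)
    (lerD (le_trans (ler_normD _ _) (lerD b1 b2)) b3)) b4)).
  have Xa : 0 <= `|x z| * a by rewrite mulr_ge0// ltW.
  have g1 : 0 <= (Ch * Cg ^+ 2 + 10 * Nm + nb) * (`|x z| * a).
    by rewrite mulr_ge0// addr_ge0 ?(ltW mean_noise_gt0)// addr_ge0 ?mulr_ge0 ?sqr_ge0// ltW.
  have g2 : 0 <= (2 * Cb * Cg + nb / 2) * a ^+ 2.
    by rewrite mulr_ge0// addr_ge0// ?mulr_ge0 ?divr_ge0// ltW.
  rewrite -subr_ge0 [X in 0 <= X](_ : _ = (Ch * Cg ^+ 2 + 10 * Nm + nb) * (`|x z| * a) +
    (2 * Cb * Cg + nb / 2) * a ^+ 2); first by rewrite addr_ge0.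
  by rewrite -/a; field.
Unshelve. all: by end_near. Qed.

End Start.
End Lyapunov.

(** * The probability of staying close to p *)

Section Stay.
Variables (K : realType) (d : nat) (R : 'M[K]_d).

(** The conditional probability that G holds at the times n, ..., n + m, given that the
    walk is at y with occupation counts s at time n.  Independent copies from the same
    state both stay with probability equal to its square. *)
Fixpoint stay (G : nat -> 'rV[K]_d -> bool) (m n : nat) (s : 'rV[K]_d) (y : 'I_d) : K :=
  if m is m'.+1 then
    (G n s)%:R * \sum_j kern R s y j * stay G m' n.+1 (s + delta_mx 0 j) j
  else (G n s)%:R.

Lemma stay_notin G m n s y : ~~ G n s -> stay G m n s y = 0.
Proof. by case: m => [|m] /= /negbTE ->; rewrite ?mul0r. Qed.

End Stay.

Section Exponential.
Variable K : realType.

Lemma expRN_le (w : K) : - (1 / 2) <= w -> expR (- w) <= 1 - w + 2 * w ^+ 2.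
Proof.
move=> w2; have w1 : 0 < 1 + w by lra.
have : expR (- w) <= (1 + w)^-1.
  by rewrite expRN lef_pV2 ?posrE ?expR_gt0// expR_ge1Dx.
move=> /le_trans; apply; rewrite -[(1 + w)^-1]mul1r ler_pdivrMr//.
rewrite -subr_ge0 (_ : _ - _ = w ^+ 2 * (1 + 2 * w)); last by ring.
by rewrite mulr_ge0 ?sqr_ge0//; lra.
Qed.

(** The second order term of the exponential is at most 2 (kap n0 D)^2.  As n0 <= n,
    n0 D^2 is at most a constant times the drift, and kap is small. *)
Lemma exp_mean_le1 (I : finType) (k D : I -> K) (n n0 X c C kap : K) :
  (forall i, 0 <= k i) -> \sum_i k i = 1 -> 1 <= n -> 0 <= n0 -> n0 <= n ->
  0 <= X -> X <= 1 -> 0 < C -> 0 < kap -> kap <= 1 / (4 * C) -> kap <= c / (4 * C ^+ 2) ->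
  (forall i, `|D i| <= C * (X / (n + 1) + (n + 1)^-1 ^+ 2)) ->
  c * (X ^+ 2 / (n + 1) + (n + 1)^-1 ^+ 2) <= \sum_i k i * D i ->
  \sum_i k i * expR (- (kap * n0 * D i)) <= 1.
Proof.
move=> k0 k1 n1 n0_ge0 n0n X0 X1 C0 kap0 kapC kapc DC cD.
have N0 : 0 < n + 1 by lra.
set a := (n + 1)^-1 in DC cD.
have a0 : 0 < a by rewrite invr_gt0.
have a1 : a <= 1 by rewrite invf_le1//; lra.
have na : n0 * a <= 1 by rewrite ler_pdivrMr//; lra.
set A := X ^+ 2 * a + a ^+ 2 in cD.
have A0 : 0 <= A by rewrite addr_ge0 ?sqr_ge0// mulr_ge0 ?sqr_ge0 ?ltW.
have th0 : 0 <= kap * n0 by rewrite mulr_ge0// ltW.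
have kC : kap * C <= 1 / 4.
  by move: kapC; rewrite ler_pdivlMr ?mulr_gt0// => H; lra.
have kc : kap * (4 * C ^+ 2) <= c.
  by move: kapc; rewrite ler_pdivlMr ?mulr_gt0// exprn_gt0.
have thD i : `|kap * n0 * D i| <= 1 / 2.
  rewrite normrM (ger0_norm th0).
  apply: (le_trans (ler_wpM2l th0 (DC i))).
  have -> : kap * n0 * (C * (X * a + a ^+ 2)) = kap * C * (n0 * a * (X + a)) by ring.
  have : n0 * a * (X + a) <= 1 * 2.
    by rewrite ler_pM ?mulr_ge0 ?addr_ge0 ?(ltW a0)//; lra.
  move=> H; have kC0 : 0 <= kap * C by rewrite mulr_ge0// ltW.
  have := ler_wpM2l kC0 H; lra.
have D2 i : D i ^+ 2 <= 2 * C ^+ 2 * a * A.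
  have := ler_pM (normr_ge0 (D i)) (normr_ge0 (D i)) (DC i) (DC i).
  rewrite -expr2 -normrX ger0_norm ?sqr_ge0// => /le_trans; apply.
  rewrite -subr_ge0 (_ : _ - _ = C ^+ 2 * ((X * a - a ^+ 2) ^+ 2 + 2 * a ^+ 3 * (1 - a))).
    rewrite mulr_ge0 ?sqr_ge0// addr_ge0 ?sqr_ge0// mulr_ge0 ?subr_ge0//.
    by rewrite mulr_ge0// exprn_ge0// ltW.
  by rewrite /A; ring.
apply: (@le_trans _ _ (\sum_i k i * (1 - kap * n0 * D i + 2 * (kap * n0) ^+ 2 * (2 * C ^+ 2 * a * A)))).
  apply: ler_sum => i _; rewrite ler_wpM2l//.
  apply: (le_trans (expRN_le _)).
    by have := thD i; rewrite ler_norml => /andP[+ _]; lra.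
  rewrite lerD2l (_ : 2 * (kap * n0 * D i) ^+ 2 = 2 * (kap * n0) ^+ 2 * D i ^+ 2);
    last by ring.
  by rewrite ler_wpM2l ?D2// mulr_ge0 ?sqr_ge0.
rewrite (eq_bigr (fun i => k i * (1 + 2 * (kap * n0) ^+ 2 * (2 * C ^+ 2 * a * A)) -
   kap * n0 * (k i * D i))); last by move=> i _; ring.
rewrite sumrB -mulr_suml k1 mul1r -mulr_sumr.
have E1 := ler_wpM2l th0 cD.
have E2 : 2 * (kap * n0) ^+ 2 * (2 * C ^+ 2 * a * A) <= kap * n0 * (c * A).
  have -> : 2 * (kap * n0) ^+ 2 * (2 * C ^+ 2 * a * A) =
    kap * n0 * (kap * (4 * C ^+ 2) * (n0 * a) * A) by ring.
  rewrite ler_wpM2l// ler_wpM2r//.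
  have kcc : 0 <= kap * (4 * C ^+ 2) by rewrite mulr_ge0 ?mulr_ge0 ?sqr_ge0// ltW.
  by apply: le_trans kc; rewrite ler_piMr.
lra.
Qed.

End Exponential.

Section StayBound.
Variables (K : realType) (d : nat) (R : 'M[K]_d) (p : 'rV[K]_d).
Implicit Types (u w s : 'rV[K]_d).
Hypotheses (R_sym : R^T = R) (R_ge0 : forall i j, 0 <= R i j)
  (p_critical : critical R p) (p_interior : forall i, 0 < p 0 i).
Hypothesis (Q_unit : fundmx R p p \in unitmx).
Variables (B : 'M[K]_d) (m : K).
Hypotheses (B_sym : B^T = B) (m_gt0 : 0 < m)
  (B_coercive : forall w, tangent w -> m * `|w| ^+ 2 <= Bform B w (dpi R p w))
  (mean_noise_gt0 : 0 < mean_noise_energy R p B).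
Local Notation nb := (mean_noise_energy R p B).
Local Notation nc := (noise_corr R p B).

Definition walk_gap (n : nat) s y s' y' : 'rV[K]_d :=
  n%:R^-1 *: ((s - s') + (corrector R p s y - corrector R p s' y')).

(** The second term averages the noise energy over the vertices.  The third term
    spends part of the noise energy still to come, so that n0 times the starting value
    at time n0 is bounded away from 0. *)
Definition lyapunov n s y s' y' : K :=
  Hfun B (walk_gap n s y s' y') + (nc y + nc y') / n%:R ^+ 2 + nb / 4 / n%:R.

Lemma corrector_scale c s y : c != 0 -> corrector R p (c *: s) y = corrector R p s y.
Proof. by move=> c0; rewrite /corrector fundmx_scale. Qed.

Definition scaled n s s' : nat * ('rV[K]_d * 'rV[K]_d) :=
  (n, (n.+1%:R^-1 *: s, n.+1%:R^-1 *: s')).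

Lemma walk_gap_scaled n s y s' y' : walk_gap n.+1 s y s' y' =
  gap R p y y' (n.+1%:R^-1 *: s) (n.+1%:R^-1 *: s') (time (scaled n s s'))^-1.
Proof.
have n0 : n.+1%:R^-1 != 0 :> K by rewrite invr_eq0 pnatr_eq0.
by rewrite /gap !corrector_scale// /walk_gap /time /scaled /= -scalerBr -scalerDr.
Qed.

Lemma lyapunov_scaled n s y s' y' : lyapunov n.+1 s y s' y' =
  Hfun B (gap R p y y' (scaled n s s').2.1 (scaled n s s').2.2 (time (scaled n s s'))^-1)
    + (nc y + nc y') / time (scaled n s s') ^+ 2 + nb / 4 / time (scaled n s s').
Proof. by rewrite /lyapunov walk_gap_scaled. Qed.

Lemma lyapunov_step n s y s' y' j j' :
  lyapunov n.+2 (s + delta_mx 0 j) j (s' + delta_mx 0 j') j' - lyapunov n.+1 s y s' y' =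
  lyapunov_incr R p B y y' (j, j') (scaled n s s').
Proof.
have n0 : n.+1%:R^-1 != 0 :> K by rewrite invr_eq0 pnatr_eq0.
have nn0 : n.+1%:R != 0 :> K by rewrite pnatr_eq0.
have nn1 : n.+1%:R + 1 != 0 :> K by rewrite gt_eqF.
rewrite /lyapunov_incr; set x := gap _ _ _ _ _ _ _; set g := gap_incr _ _ _ _ _ _ _ _.
have x1E : walk_gap n.+2 (s + delta_mx 0 j) j (s' + delta_mx 0 j') j' =
    x + (n.+1%:R + 1)^-1 *: g.
  rewrite /g /gap_incr -/x /corr_incr /= !corrector_scale// -!scalerDr !corrector_scale//.
  rewrite /x -walk_gap_scaled /walk_gap -[n.+2%:R]natr1.
  move: nn0 nn1; move: (n.+1%:R : K) => N nn0 nn1.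
  apply/rowP => i; rewrite !mxE.
  by field; rewrite nn0 nn1.
rewrite /lyapunov x1E walk_gap_scaled -/x Hfun_Bform// /time /= -[n.+2%:R]natr1.
move: (Hfun B x) (Hfun B g) (Bform B x g) nn0 nn1 => h1 h2 h3.
by move: (n.+1%:R : K) => N nn0 nn1; field; rewrite nn0 nn1.
Qed.

Lemma late_nearP (P : nat * ('rV[K]_d * 'rV[K]_d) -> Prop) :
  (\forall z \near late_near p, P z) -> exists2 e, 0 < e & exists n1, forall n v v',
    (n1 <= n)%N -> `|v - p| <= e -> `|v' - p| <= e -> P (n, (v, v')).
Proof.
move=> [[A1 A2] /= [[n1 _ n1A] [[B1 B2] /= [nB1 nB2] BA]] AP].
have /nbhs_ballP[e1 /= e1_gt0 e1B] := nB1.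
have /nbhs_ballP[e2 /= e2_gt0 e2B] := nB2.
exists (Num.min e1 e2 / 2); first by rewrite divr_gt0// lt_min e1_gt0.
exists n1 => n v v' n1n vp v'p; apply: AP; split; first exact: n1A.
apply: BA; split => /=.
  apply: e1B; rewrite -ball_normE /= distrC (le_lt_trans vp)//.
  rewrite ltr_pdivrMr// (@le_lt_trans _ _ e1) ?ge_min ?lexx//; lra.
apply: e2B; rewrite -ball_normE /= distrC (le_lt_trans v'p)//.
rewrite ltr_pdivrMr// (@le_lt_trans _ _ e2) ?ge_min ?lexx ?orbT//; lra.
Qed.

Lemma uniform_drift : exists c C, [/\ 0 < c, 0 < C &
  \forall z \near late_near p, forall y y', [/\ tangent (z.2.1 - z.2.2) ->
     c * (`|gap R p y y' z.2.1 z.2.2 (time z)^-1| ^+ 2 / (time z + 1)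
          + (time z + 1)^-1 ^+ 2)
       <= \sum_jj pairk R z.2.1 z.2.2 y y' jj * lyapunov_incr R p B y y' jj z,
   forall jj, `|lyapunov_incr R p B y y' jj z| <=
     C * (`|gap R p y y' z.2.1 z.2.2 (time z)^-1| / (time z + 1)
          + (time z + 1)^-1 ^+ 2)
   & `|gap R p y y' z.2.1 z.2.2 (time z)^-1| <= 1]].
Proof.
pose c := Num.min m (nb / 2).
have c0 : 0 < c by rewrite lt_min m_gt0 divr_gt0.
have cm : c <= m by rewrite ge_min lexx.
have cn : c <= nb / 2 by rewrite ge_min lexx orbT.
have H y y' := lyapunov_drift R_sym R_ge0 p_critical p_interior Q_unit B_sym m_gt0 B_coercive
  mean_noise_gt0 y y' c0 cm cn.
pose C y y' := sval (cid2 (H y y')).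
have C_gt0 y y' : 0 < C y y' by rewrite /C; case: cid2.
exists c, (\sum_y \sum_y' C y y' + 1); split => //.
  by rewrite ltr_wpDl// sumr_ge0// => y _; rewrite sumr_ge0// => y' _; rewrite ltW.
apply: filter_forall => y; apply: filter_forall => y'.
have : \forall z \near late_near p, [/\ tangent (z.2.1 - z.2.2) ->
     c * (`|gap R p y y' z.2.1 z.2.2 (time z)^-1| ^+ 2 / (time z + 1)
          + (time z + 1)^-1 ^+ 2)
       <= \sum_jj pairk R z.2.1 z.2.2 y y' jj * lyapunov_incr R p B y y' jj z,
   forall jj, `|lyapunov_incr R p B y y' jj z| <=
     C y y' * (`|gap R p y y' z.2.1 z.2.2 (time z)^-1| / (time z + 1)
          + (time z + 1)^-1 ^+ 2)
   & `|gap R p y y' z.2.1 z.2.2 (time z)^-1| <= 1].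
  by rewrite /C; case: cid2.
apply: filterS => z [P1 P2 P3]; split => // jj.
apply: (le_trans (P2 jj)); rewrite ler_wpM2r//.
  rewrite addr_ge0 ?sqr_ge0// divr_ge0// addr_ge0//; have := @time_ge1 _ _ z; lra.
have C1 : C y y' <= \sum_y' C y y'.
  by rewrite [leRHS](bigD1 y')// lerDl; apply: sumr_ge0 => k _; exact: ltW.
have C2 : \sum_y' C y y' <= \sum_y \sum_y' C y y'.
  rewrite [leRHS](bigD1 y)// lerDl; apply: sumr_ge0 => i _.
  by apply: sumr_ge0 => k _; exact: ltW.
by rewrite (le_trans (le_trans C1 C2))// lerDl.
Qed.

Lemma lyapunov_cvg0 y y' : Hfun B (gap R p y y' z.2.1 z.2.2 (time z)^-1)
  + (nc y + nc y') / time z ^+ 2 + nb / 4 / time z @[z --> late_near p] --> 0.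
Proof.
have H0 : Hfun B 0 = 0 by rewrite -(scale0r (0 : 'rV[K]_d)) HfunZ expr0n mul0r.
have -> : 0 = Hfun B 0 + (nc y + nc y') * (0 * 0) + nb / 4 * 0 :> K.
  by rewrite H0 !mulr0 !addr0.
apply: cvgD; last by apply: cvgM; [exact: cvg_cst|exact: late_near_time].
apply: cvgD.
  apply: Hfun_cvg.
  exact: (gap_cvg p_critical p_interior Q_unit
    (@late_near_fst _ _ p) (@late_near_snd _ _ p) (@late_near_time _ _ p)).
apply: cvgM; first exact: cvg_cst.
by under eq_fun do rewrite expr2 invfM; apply: cvgM; exact: late_near_time.
Qed.

(** The supermartingale is compared with [stay] by backward induction from a time so
    late that the Lyapunov function is negligible on allowed states.  At time n0 both
    copies are in the same state, so the gap is 0 and only the noise still to come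
    remains. *)
Lemma stay_bound (G : nat -> 'rV[K]_d -> bool) :
  (forall n s, G n s -> \sum_i s 0 i = n%:R) ->
  (forall e, 0 < e -> exists N, forall n s, (N <= n)%N -> G n s ->
     `|n%:R^-1 *: s - p| <= e) ->
  exists2 c, c < 1 & exists n1, forall n s y, (n1 <= n)%N ->
    exists k, stay R G k n s y <= c.
Proof.
move=> G_sum G_cvg.
have [c [C [c0 C0 drift]]] := uniform_drift.
(* kap makes the exponents at most 1 / 2 and their squares smaller than the drift *)
pose kap := Num.min (1 / (4 * C)) (c / (4 * C ^+ 2)).
have kap0 : 0 < kap by rewrite lt_min !divr_gt0// ?mulr_gt0 ?exprn_gt0.
have kap1 : kap <= 1 / (4 * C) by rewrite ge_min lexx.
have kap2 : kap <= c / (4 * C ^+ 2) by rewrite ge_min lexx orbT.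
have regF1 : \forall z \near late_near p, regular R p z.2.1.
  exact: near_v_regular (@late_near_fst _ _ p).
have regF2 : \forall z \near late_near p, regular R p z.2.2.
  exact: near_v_regular (@late_near_snd _ _ p).
have [e e_gt0 [n1 drift1]] := late_nearP (filterI drift (filterI regF1 regF2)).
have [N1 N1P] := G_cvg _ e_gt0.
pose Nm := \sum_j `|nc j|.
have NmP j : `|nc j| <= Nm by rewrite /Nm (bigD1 j)//= lerDl sumr_ge0.
(* from time n2 on, the 1 / n^2 term of the starting value is at most half of the
   1 / n term *)
pose n2 := Num.bound (16 * Nm / nb).
exists (expR (- (kap * nb / 32))).
  by rewrite -expR0 ltr_expR oppr_lt0 divr_gt0// mulr_gt0.
exists (maxn N1 (maxn n1.+1 n2)) => n0 s y.
rewrite !geq_max => /and3P[n0N1 n0n1 n0n2].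
have n0_gt0 : (0 < n0)%N by rewrite (leq_trans _ n0n1).
have n0K : 0 < n0%:R :> K by rewrite ltr0n.
(* half of the exponent gained at the start, given up at the end *)
pose eta := kap * nb / 16.
have eta0 : 0 < eta by rewrite divr_gt0// mulr_gt0.
have small : \forall z \near late_near p, forall y y',
    Hfun B (gap R p y y' z.2.1 z.2.2 (time z)^-1)
    + (nc y + nc y') / time z ^+ 2 + nb / 4 / time z <= eta / (kap * n0%:R).
  apply: filter_forall => y1; apply: filter_forall => y2.
  by apply: (cvgr_le _ (@lyapunov_cvg0 y1 y2)); rewrite divr_gt0// mulr_gt0.
have [e' e'_gt0 [n3 small']] := late_nearP small.
have [N2 N2P] := G_cvg _ e'_gt0.
pose N := maxn n0 (maxn N2 n3.+1).
have th0 : 0 <= kap * n0%:R by rewrite mulr_ge0// ltW.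
have main k : forall n, (n + k)%N = N -> (n0 <= n)%N -> forall s y s' y',
    stay R G k n s y * stay R G k n s' y' * expR (- eta)
      <= expR (- (kap * n0%:R * lyapunov n s y s' y')).
  elim: k => [|k IH] n nkN n0n s1 y1 s2 y2.
    rewrite /=.
    case G1 : (G n s1); last by rewrite !mul0r expR_ge0.
    case G2 : (G n s2); last by rewrite mulr0 mul0r expR_ge0.
    rewrite !mul1r ler_expR lerN2.
    case: n nkN n0n G1 G2 => [|n] nkN n0n G1 G2.
      by move: n0_gt0; rewrite leqn0 in n0n; rewrite (eqP n0n).
    rewrite addn0 in nkN.
    have n3n : (n3 <= n)%N by rewrite -ltnS nkN !leq_max leqnn !orbT.
    have N2n : (N2 <= n.+1)%N by rewrite nkN !leq_max leqnn !orbT.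
    have sm := small' n _ _ n3n (N2P _ _ N2n G1) (N2P _ _ N2n G2) y1 y2.
    rewrite lyapunov_scaled [leLHS]mulrC -ler_pdivlMr; last by rewrite mulr_gt0.
    exact: sm.
  have [G1|G1] := boolP (G n s1); last by rewrite (stay_notin _ _ _ G1) !mul0r expR_ge0.
  have [G2|G2] := boolP (G n s2); last by rewrite (stay_notin _ _ _ G2) mulr0 mul0r expR_ge0.
  rewrite /= G1 G2 !mul1r pair_sum_mul mulr_suml.
  case: n nkN n0n G1 G2 => [|n] nkN n0n G1 G2.
      by move: n0_gt0; rewrite leqn0 in n0n; rewrite (eqP n0n).
  have s1p : `|n.+1%:R^-1 *: s1 - p| <= e by apply: N1P G1; exact: leq_trans n0n.
  have s2p : `|n.+1%:R^-1 *: s2 - p| <= e by apply: N1P G2; exact: leq_trans n0n.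
  have n1n : (n1 <= n)%N by rewrite -ltnS (leq_trans n0n1).
  have [dr [reg1 reg2]] := drift1 n _ _ n1n s1p s2p.
  have [/(_ _)dr1 dr2 dr3] := dr y1 y2.
  have [ka1 ksum1] := kern_regular R_ge0 y1 reg1.
  have [ka2 ksum2] := kern_regular R_ge0 y2 reg2.
  have nn0 : n.+1%:R^-1 != 0 :> K by rewrite invr_eq0 pnatr_eq0.
  have kE jj : pairk R (n.+1%:R^-1 *: s1) (n.+1%:R^-1 *: s2) y1 y2 jj =
      kern R s1 y1 jj.1 * kern R s2 y2 jj.2.
    by rewrite /pairk !kern_scale.
  have k2_ge0 jj : 0 <= pairk R (n.+1%:R^-1 *: s1) (n.+1%:R^-1 *: s2) y1 y2 jj by rewrite mulr_ge0.
  have k2_sum : \sum_jj pairk R (n.+1%:R^-1 *: s1) (n.+1%:R^-1 *: s2) y1 y2 jj = 1.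
    by rewrite -pair_sum_mul ksum1 ksum2 mulr1.
  have tan : tangent (n.+1%:R^-1 *: s1 - n.+1%:R^-1 *: s2).
    rewrite /tangent /=; under eq_bigr do rewrite mxE [X in X + _]mxE [X in _ + X]mxE [X in - X]mxE.
    by rewrite sumrB -!mulr_sumr (G_sum _ _ G1) (G_sum _ _ G2) subrr.
  have n0le : n0%:R <= time (scaled n s1 s2) by rewrite /time ler_nat.
  have E := exp_mean_le1 k2_ge0 k2_sum (time_ge1 (scaled n s1 s2)) (ltW n0K)
    n0le (normr_ge0 _) dr3 C0 kap0 kap1 kap2 dr2 (dr1 tan).
  apply: (@le_trans _ _ (\sum_jj pairk R (n.+1%:R^-1 *: s1) (n.+1%:R^-1 *: s2) y1 y2 jj *
     expR (- (kap * n0%:R * lyapunov_incr R p B y1 y2 jj (scaled n s1 s2))) *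
     expR (- (kap * n0%:R * lyapunov n.+1 s1 y1 s2 y2)))); last first.
    by rewrite -mulr_suml ler_piMl ?expR_ge0.
  apply: ler_sum => -[j1 j2] _ /=.
  rewrite [X in X * _ <= _](_ : _ = pairk R (n.+1%:R^-1 *: s1) (n.+1%:R^-1 *: s2) y1 y2 (j1, j2) *
    (stay R G k n.+2 (s1 + delta_mx 0 j1) j1 * stay R G k n.+2 (s2 + delta_mx 0 j2) j2)); last first.
    by rewrite kE /=; ring.
  move: (pairk _ _ _ _ _ _) (k2_ge0 (j1, j2)) => q q0.
  rewrite -[leLHS]mulrA -[leRHS]mulrA ler_wpM2l//.
  have nkN' : (n.+2 + k)%N = N by rewrite -nkN !addSn addnS.
  have IH' := IH n.+2 nkN' (leqW n0n) (s1 + delta_mx 0 j1) j1 (s2 + delta_mx 0 j2) j2.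
  apply: (le_trans IH').
  rewrite -expRD ler_expR -opprD lerN2 -mulrDr ler_wpM2l//.
  by rewrite -lyapunov_step subrK.
exists (N - n0)%N.
have := main (N - n0)%N n0 (subnKC (leq_maxl _ _)) (leqnn _) s y s y.
set W := stay _ _ _ _ _ _ => WW.
have PsiE : kap * nb / 8 <= kap * n0%:R * lyapunov n0 s y s y.
  have -> : kap * n0%:R * lyapunov n0 s y s y = kap * (2 * (nc y * n0%:R^-1) + nb / 4).
    rewrite /lyapunov /walk_gap !subrr addr0 scaler0.
    have -> : Hfun B 0 = 0 by rewrite -(scale0r (0 : 'rV[K]_d)) HfunZ expr0n mul0r.
    by field; rewrite lt0r_neq0.
  have : `|nc y| * n0%:R^-1 <= nb / 16.
    rewrite ler_pdivrMr// (le_trans (NmP y))//.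
    have : 16 * Nm / nb <= n0%:R.
      apply: (@le_trans _ _ n2%:R); last by rewrite ler_nat.
      apply/ltW/archi_boundP; apply: divr_ge0; last exact: ltW.
      by rewrite mulr_ge0// sumr_ge0.
    by rewrite ler_pdivrMr// => H; lra.
  have := ler_norm (- (nc y * n0%:R^-1)); rewrite normrN normrM [`|_^-1|]gtr0_norm ?invr_gt0//.
  move=> H1 H2; rewrite -mulrA ler_wpM2l ?(ltW kap0)//.
  lra.
have W2 : W * W <= expR (- (kap * nb / 32)) * expR (- (kap * nb / 32)).
  rewrite -expRD.
  have : W * W * expR (- eta) <= expR (- (kap * nb / 8)).
    by apply: (le_trans WW); rewrite ler_expR lerN2.
  rewrite -ler_pdivlMr ?expR_gt0// -expRN opprK -expRD => /le_trans; apply.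
  by rewrite ler_expR /eta; lra.
rewrite leNgt; apply/negP => lt.
have := ltr_pM (expR_ge0 _) (expR_ge0 _) lt lt.
by rewrite ltNge W2.
Qed.

End StayBound.

(** * Reducible kernels and the general bound *)

Section StayBoundAll.
Variables (K : realType) (d : nat) (R : 'M[K]_d) (p : 'rV[K]_d).
Implicit Types (u w s : 'rV[K]_d).
Hypotheses (R_sym : R^T = R) (R_ge0 : forall i j, 0 <= R i j)
  (R_unit : R \in unitmx)
  (p_critical : critical R p) (p_interior : forall i, 0 < p 0 i).

Section Reducible.
Variable phi : 'I_d -> K.
Hypothesis phi_harmonic : forall y, \sum_j kern R p y j * phi j = phi y.

(** The Dirichlet form of a harmonic function vanishes. *)
Lemma harmonic_const y j : R y j != 0 -> phi j = phi y.
Proof.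
move=> Ryj; have h0 := critical_H_gt0 p_critical.
have kp y' j' : kern R p y' j' = R y' j' * p 0 j' / Hfun R p by rewrite kern_p.
have E : \sum_y p 0 y * \sum_j kern R p y j * (phi j - phi y) ^+ 2 = 0.
  rewrite (eq_bigr (fun y => p 0 y * (\sum_j kern R p y j * phi j ^+ 2) - p 0 y * phi y ^+ 2)).
    by rewrite sumrB p_kern_sum// subrr.
  move=> i _.
  have -> : \sum_j kern R p i j * (phi j - phi i) ^+ 2 =
     \sum_j kern R p i j * phi j ^+ 2 - 2 * phi i * (\sum_j kern R p i j * phi j)
     + phi i ^+ 2 * \sum_j kern R p i j.
    rewrite !mulr_sumr -sumrB -big_split; apply: eq_bigr => l _ /=; ring.
  by rewrite phi_harmonic kern_p_sum//; ring.
have t_ge0 i l : 0 <= kern R p i l * (phi l - phi i) ^+ 2.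
  by rewrite mulr_ge0 ?sqr_ge0 ?kern_p_ge0.
have s_ge0 i : 0 <= p 0 i * \sum_l kern R p i l * (phi l - phi i) ^+ 2.
  by rewrite mulr_ge0 ?sumr_ge0// ltW.
move/eqP: E; rewrite psumr_eq0// => /allP /(_ y (mem_index_enum _)) /=.
rewrite mulf_eq0 gt_eqF//= psumr_eq0// => /allP /(_ j (mem_index_enum _)) /=.
rewrite kp !mulf_eq0 (negbTE Ryj) gt_eqF//= invr_eq0 gt_eqF//= orbb subr_eq0.
by move/eqP.
Qed.

(** The walk never leaves the level set of phi that contains y, so the count of a
    vertex j outside it does not change. *)
Lemma stay_reducible (G : nat -> 'rV[K]_d -> bool) k n s y j : phi j != phi y ->
  (forall s', s' 0 j = s 0 j -> ~~ G (n + k)%N s') -> stay R G k n s y = 0.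
Proof.
elim: k n s y => [|k IH] n s y phij nG.
  by apply: stay_notin; have := nG s erefl; rewrite addn0.
rewrite /= big1 ?mulr0// => l _.
have [R0|R0] := eqVneq (R y l) 0; first by rewrite /kern R0 !mul0r.
have pl := harmonic_const R0.
rewrite IH ?mulr0//; first by rewrite pl.
move=> s' s'j; rewrite addSnnS; apply: nG; rewrite s'j !mxE eqxx /=.
case: eqP => [jl|_]; last by rewrite addr0.
by move: phij; rewrite jl pl eqxx.
Qed.

End Reducible.

Lemma fundmx_singular : fundmx R p p \notin unitmx ->
  exists2 phi : 'I_d -> K, (forall y, \sum_j kern R p y j * phi j = phi y) &
    forall y, exists j, phi j != phi y.
Proof.
rewrite unitmxE unitfE negbK -det_tr => /det0P[v v0 vQ].
have E y : v 0 y - \sum_j kern R p y j * v 0 j + \sum_j p 0 j * v 0 j = 0.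
  have /rowP/(_ y) := vQ; rewrite !mxE.
  rewrite (eq_bigr (fun j => (y == j)%:R * v 0 j - kern R p y j * v 0 j + p 0 j * v 0 j)).
    rewrite !big_split /= sumrN (bigD1 y)//= eqxx mul1r big1 ?addr0// => j /negbTE jy.
    by rewrite eq_sym jy mul0r.
  by move=> j _; rewrite !mxE; ring.
have S0 : \sum_j p 0 j * v 0 j = 0.
  have : \sum_y p 0 y * (v 0 y - \sum_j kern R p y j * v 0 j + \sum_j p 0 j * v 0 j) = 0.
    by apply: big1 => y _; rewrite E mulr0.
  rewrite (eq_bigr (fun y => p 0 y * v 0 y - p 0 y * (\sum_j kern R p y j * v 0 j)
    + p 0 y * \sum_j p 0 j * v 0 j)); last by move=> y _; ring.
  rewrite big_split sumrB /= p_kern_sum// subrr add0r -mulr_suml.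
  by rewrite (critical_sum p_critical) mul1r.
exists (fun j => v 0 j).
  by move=> y; have := E y; rewrite S0 addr0 => /eqP; rewrite subr_eq0 => /eqP.
move=> y; apply: contrapT => /forallNP vconst.
have vE j : v 0 j = v 0 y by apply/eqP; have := vconst j; move/negP; rewrite negbK.
move: S0; under eq_bigr do rewrite vE.
rewrite -mulr_suml (critical_sum p_critical) mul1r => vy0.
by move/eqP: v0; apply; apply/rowP => j; rewrite vE vy0 mxE.
Qed.

Lemma stay_bound_all (G : nat -> 'rV[K]_d -> bool) :
  (exists2 w, tangent w & 0 < Hfun R w) ->
  (forall n s, G n s -> \sum_i s 0 i = n%:R) ->
  (forall e, 0 < e -> exists N, forall n s, (N <= n)%N -> G n s ->
     `|n%:R^-1 *: s - p| <= e) ->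
  exists2 c, c < 1 & exists n1, forall n s y, (n1 <= n)%N ->
    exists k, stay R G k n s y <= c.
Proof.
move=> unstable G_sum G_cvg.
have [Qu|Qs] := boolP (fundmx R p p \in unitmx).
  have [a a_gt0 [w [w_tan w_neq0]]] :=
    (tangent_eigenvalueP R_sym p_critical p_interior).2 unstable.
  rewrite pi_derivativeE// => w_eig.
  pose th i := w 0 i / p 0 i.
  have th_eig y : \sum_j kern R p y j * th j = a * th y.
    have /rowP/(_ y) := w_eig; rewrite !mxE w_tan mulr0 subr0 => E.
    rewrite /th mulrA -E mulrAC [p 0 y * _]mulrC mulfK ?gt_eqF//.
    rewrite /Nfun mulr_suml; apply: eq_bigr => j _; rewrite kern_p//.
    by field; rewrite !gt_eqF// (critical_H_gt0 p_critical).
  have th_mean : \sum_i p 0 i * th i = 0.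
    rewrite -[RHS]w_tan; apply: eq_bigr => i _.
    by rewrite /th mulrCA divff ?mulr1// gt_eqF.
  have th_neq0 : exists i, th i != 0.
    apply: contrapT => /forallNP th0; move/eqP: w_neq0; apply; apply/rowP => i.
    have := th0 i; move/negP; rewrite negbK mulf_eq0 invr_eq0 (gt_eqF (p_interior i)) orbF.
    by rewrite mxE => /eqP.
  have [M M0 nb0] := noise_var_gt0 R_sym R_ge0 p_critical p_interior Qu a_gt0
    th_eig th_mean th_neq0.
  have [m m0 mP] := drift_coercive R_sym R_unit p_critical p_interior a_gt0 th_eig M0.
  exact: (stay_bound R_sym R_ge0 p_critical p_interior Qu
    (boosted_form_sym R_sym th M) m0 mP nb0 G_sum G_cvg).
have [phi phi_h phi_nc] := fundmx_singular Qs.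
exists 0 => //; exists 0%N => n s y _.
have [j phij] := phi_nc y.
have pj2 : 0 < p 0 j / 2 by rewrite divr_gt0.
have [N NP] := G_cvg _ pj2.
pose b := Num.bound (`|s 0 j| / (p 0 j / 2)).
pose N' := maxn N (maxn n b.+1).
exists (N' - n)%N; rewrite (stay_reducible phi_h phij)// => s' s'j.
have nN' : (n <= N')%N by rewrite !leq_max leqnn orbT.
rewrite subnKC//; apply/negP => Gs'.
have NN' : (N <= N')%N by rewrite leq_max leqnn.
have := le_trans (coord_le_norm _ j) (NP _ _ NN' Gs').
rewrite !mxE s'j.
have bN' : `|s 0 j| / (p 0 j / 2) < N'%:R.
  apply: (@lt_le_trans _ _ b%:R).
    by apply: archi_boundP; rewrite divr_ge0// ltW.
  by rewrite ler_nat !leq_max leqnSn !orbT.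
have N'0 : 0 < N'%:R :> K by rewrite ltr0n !leq_max !orbT.
rewrite ltr_pdivrMr// in bN'.
have : `|N'%:R^-1 * s 0 j| < p 0 j / 2.
  by rewrite normrM gtr0_norm ?invr_gt0// ltr_pdivrMl.
rewrite ler_norml ltr_norml => /andP[_ H1] /andP[H2 _].
by move: H1 H2; lra.
Qed.

End StayBoundAll.

(** * Events of the walk *)

Section Walk.
Variables (K : realType) (disp : measure_display) (T : measurableType disp)
  (P : probability T K) (d : nat) (Y : nat -> T -> 'I_d) (S : nat -> T -> 'rV[K]_d)
  (R : 'M[K]_d) (d_gt0 : (0 < d)%N).
Hypothesis walk : is_VRRW P Y S R d_gt0.
Implicit Types (s : 'rV[K]_d) (y j : 'I_d) (A B E : set T).

Local Notation filt := (natural_filtration Y).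

Definition pr A : K := fine (P A).

Lemma prE A : measurable A -> P A = (pr A)%:E.
Proof. by move=> mA; rewrite fineK// fin_num_measure. Qed.

Lemma pr_ge0 A : 0 <= pr A.
Proof. exact: fine_ge0. Qed.

Lemma pr_le A B : measurable A -> measurable B -> A `<=` B -> pr A <= pr B.
Proof.
by move=> mA mB AB; rewrite -lee_fin -!prE// le_measure// inE.
Qed.

Lemma filtration_setI n A B : filt n A -> filt n B -> filt n (A `&` B).
Proof. exact: (@measurableI _ (g_sigma_algebraType _)). Qed.

Lemma filtration_bigU n (f : 'I_d -> set T) : (forall j, filt n (f j)) ->
  filt n (\big[setU/set0]_(j < d) f j).
Proof.
move=> Ff; apply: (big_ind (filt n)) => // [|A B FA FB]; first exact: sigma_algebra0.
exact: (@measurableU _ (g_sigma_algebraType _)).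
Qed.

Lemma filtration_const n (Q : Prop) : filt n [set _ | Q].
Proof.
have F0 : filt n set0 by exact: sigma_algebra0.
have [q|q] := pselect Q.
  have -> : [set _ | Q] = ~` (set0 : set T) by apply/seteqP; split => x // _ [].
  exact: sigma_algebraC.
by have -> : [set _ | Q] = (set0 : set T) by apply/seteqP; split => x.
Qed.

Lemma filtration_mono n k : (n <= k)%N -> filt n `<=` filt k.
Proof.
move=> nk; apply: sub_sigma_algebra2 => A [l [i [/andP[dl ln] ->]]].
by exists l, i; rewrite dl (leq_trans ln).
Qed.

Lemma filtration_Y n k i : (d <= k <= n)%N -> filt n [set x | Y k x = i].
Proof. by move=> dkn; apply: sub_sigma_algebra; exists k, i. Qed.

Lemma filtration_measurable n A : filt n A -> measurable A.
Proof.
suff : filt n `<=` measurable by apply.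
apply: smallest_sub; first exact: sigma_algebra_measurable.
by move=> _ [k [i [/andP[dk _] ->]]]; exact: (VRRW_measurable walk).
Qed.


Lemma walk_step n x : (d <= n)%N -> S n.+1 x = S n x + delta_mx 0 (Y n.+1 x).
Proof.
move=> dn; apply/rowP => i; rewrite (VRRW_S_step walk)// !mxE eqxx /=.
by rewrite eq_sym.
Qed.

Lemma walk_init x : S d x = const_mx 1.
Proof. by apply/rowP => i; rewrite (VRRW_S_init walk) mxE. Qed.

Lemma walk_sum n x : (d <= n)%N -> \sum_i S n x 0 i = n%:R.
Proof.
elim: n => [|n IH].
  by rewrite leqNgt d_gt0.
rewrite leq_eqVlt => /orP[/eqP <-|dn].
  under eq_bigr do rewrite (VRRW_S_init walk).
  by rewrite sumr_const card_ord.
rewrite walk_step//; under eq_bigr do rewrite mxE.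
rewrite big_split /= IH// -[n.+1%:R]natr1; congr (_ + _).
rewrite (bigD1 (Y n.+1 x))//= mxE !eqxx big1 ?addr0// => i /negbTE iy.
by rewrite mxE iy andbF.
Qed.

Lemma bigU_Y n A : \big[setU/set0]_(j < d) (A `&` [set x | Y n x = j]) = A.
Proof.
apply/seteqP; split=> x; rewrite -bigcup_seq /=; first by case=> j _ [].
by move=> Ax; exists (Y n x) => //=; rewrite mem_index_enum.
Qed.

(** The counts are functions of the finitely many past positions, so any set of
    values, without a measurability condition, gives an event of the past. *)
Lemma filtration_S (Q : 'rV[K]_d -> Prop) n : (d <= n)%N -> filt n [set x | Q (S n x)].
Proof.
elim: n Q => [|n IH] Q; first by rewrite leqNgt d_gt0.
rewrite leq_eqVlt => /orP[/eqP <-|dn].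
  under eq_set do rewrite walk_init; exact: filtration_const.
rewrite -(bigU_Y n.+1 [set x | _]); apply: filtration_bigU => j.
rewrite (_ : _ `&` _ = [set x | Q (S n x + delta_mx 0 j)] `&` [set x | Y n.+1 x = j]).
  apply: filtration_setI; last by apply: filtration_Y; rewrite ltnW//=.
  by apply: (@filtration_mono n); [exact: leqnSn|apply: (IH (fun s => Q (s + delta_mx 0 j)))].
by apply/seteqP; split => x /= [+ yj]; rewrite walk_step// yj.
Qed.

Lemma pr_split n A : (d <= n)%N -> measurable A ->
  pr A = \sum_j pr (A `&` [set x | Y n x = j]).
Proof.
move=> dn mA.
have mAY j : measurable (A `&` [set x | Y n x = j]).
  by apply: measurableI => //; exact: (VRRW_measurable walk).
apply: EFin_inj; rewrite -prE// -sumEFin -[in LHS](bigU_Y n A).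
rewrite measure_bigsetU_ord//; first by apply: eq_bigr => j _; exact: prE.
apply/trivIsetP => i j _ _ /eqP ij; apply/seteqP; split => x //=.
by move=> -[[_ yi] [_ yj]]; case: ij; rewrite -yi.
Qed.

(** On such an event of the past, the conditional law of the future is that of
    the walk restarted from (s, y). *)
Definition state_on n s y B := forall x, B x -> S n x = s /\ Y n x = y.

Lemma transition_pr n s y B j : (d <= n)%N -> filt n B -> state_on n s y B ->
  pr (B `&` [set x | Y n.+1 x = j]) = kern R s y j * pr B.
Proof.
move=> dn FB Bs; have mB := filtration_measurable FB.
have mY : measurable [set x | Y n.+1 x = j] by apply: (VRRW_measurable walk); exact: leqW.
have mBY : measurable ([set x | Y n.+1 x = j] `&` B) by exact: measurableI.
have [_ _ /(_ B FB) E] := VRRW_transition walk j dn.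
apply: EFin_inj; rewrite setIC EFinM -(prE mBY) -(prE mB) -E -integral_cst//.
by apply: eq_integral => x /set_mem /Bs [Sx Yx]; rewrite /= /kern /Nfun Sx Yx.
Qed.

Variable G : nat -> 'rV[K]_d -> bool.

Fixpoint good (m n : nat) : set T :=
  if m is m'.+1 then [set x | G n (S n x)] `&` good m' n.+1 else [set x | G n (S n x)].

Lemma good_measurable m n : (d <= n)%N -> measurable (good m n).
Proof.
elim: m n => [|m IH] n dn /=.
  by apply: (@filtration_measurable n); apply: (filtration_S (fun s => G n s)).
apply: measurableI; last by apply: IH; exact: leqW.
by apply: (@filtration_measurable n); apply: (filtration_S (fun s => G n s)).
Qed.

Lemma pr_good m n s y B : (d <= n)%N -> filt n B -> state_on n s y B ->
  pr (B `&` good m n) = stay R G m n s y * pr B.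
Proof.
elim: m n s y B => [|m IH] n s y B dn FB Bs /=.
  case GE : (G n s).
    rewrite mul1r; congr pr; apply/seteqP; split => x; first by case.
    by move=> Bx; split => //=; case: (Bs _ Bx) => ->.
  rewrite mul0r (_ : _ `&` _ = set0) ?/pr ?measure0//.
  by apply/seteqP; split => x //= -[Bx]; case: (Bs _ Bx) => ->; rewrite GE.
case GE : (G n s); last first.
  rewrite !mul0r (_ : _ `&` _ = set0) ?/pr ?measure0//.
  by apply/seteqP; split => x //= -[Bx []]; case: (Bs _ Bx) => ->; rewrite GE.
rewrite mul1r.
have -> : B `&` ([set x | G n (S n x)] `&` good m n.+1) = B `&` good m n.+1.
  apply/seteqP; split => x; first by case=> ? [].
  by move=> [Bx gx]; split => //; split => //=; case: (Bs _ Bx) => ->.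
have mB := filtration_measurable FB.
rewrite (@pr_split n.+1) ?leqW//; last first.
  by apply: measurableI => //; apply: good_measurable; exact: leqW.
rewrite mulr_suml; apply: eq_bigr => j _.
rewrite setIAC (IH n.+1 (s + delta_mx 0 j) j); [|exact: leqW| |].
- by rewrite (transition_pr j dn FB Bs); ring.
- apply: filtration_setI; first exact: (@filtration_mono n).
  by apply: filtration_Y; rewrite leqW//=.
- move=> x [Bx /= Yx]; case: (Bs _ Bx) => Sx _.
  by rewrite walk_step// Sx Yx.
Qed.

(** Every event of the past is a finite disjoint union of events with a constant
    state, obtained by fixing the positions one after the other. *)
Lemma pr_event_le n E c : (d <= n)%N -> measurable E ->
  (forall B s y, filt n B -> state_on n s y B -> pr (B `&` E) <= c * pr B) ->
  forall B, filt n B -> pr (B `&` E) <= c * pr B.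
Proof.
move=> dn mE H.
suff claim k : forall m, (m + k)%N = n -> (d <= m)%N ->
    forall s y B, filt n B -> state_on m s y B -> pr (B `&` E) <= c * pr B.
  move=> B FB; apply: (claim (n - d)%N d (subnKC dn) (leqnn _) (const_mx 1) (Ordinal d_gt0)) => //.
  by move=> x _; rewrite walk_init (VRRW_Y_init walk).
elim: k => [|k IH] m mkn dm s y B FB Bs.
  by rewrite addn0 in mkn; apply: (H B s y) => //; rewrite -mkn.
have mB := filtration_measurable FB.
have m1n : (m.+1 <= n)%N by rewrite -mkn addnS ltnS leq_addr.
have dm1 : (d <= m.+1)%N by exact: leqW.
rewrite (pr_split dm1 mB) (pr_split dm1 (measurableI _ _ mB mE)) mulr_sumr.
apply: ler_sum => j _; rewrite setIAC.
apply: (IH m.+1 _ dm1 (s + delta_mx 0 j) j); first by rewrite addSnnS.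
  by apply: filtration_setI => //; apply: filtration_Y; rewrite dm1.
by move=> x [Bx /= Yx]; case: (Bs _ Bx) => Sx _; rewrite walk_step// Sx Yx.
Qed.

End Walk.

(** * Nonconvergence *)

Section NonConvergence.
Variables (K : realType) (disp : measure_display) (T : measurableType disp)
  (P : probability T K) (d : nat) (Y : nat -> T -> 'I_d) (S : nat -> T -> 'rV[K]_d)
  (R : 'M[K]_d) (d_gt0 : (0 < d)%N) (p : 'rV[K]_d).
Hypothesis walk : is_VRRW P Y S R d_gt0.
Hypotheses (R_sym : R^T = R) (R_ge0 : forall i j, 0 <= R i j)
  (R_unit : R \in unitmx)
  (p_critical : critical R p) (p_interior : forall i, 0 < p 0 i)
  (unstable : exists2 w, tangent w & 0 < Hfun R w).
Local Notation filt := (natural_filtration Y).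
Local Notation pr := (pr P).

Lemma measurable_S (Q : 'rV[K]_d -> Prop) n : (d <= n)%N -> measurable [set x | Q (S n x)].
Proof. by move=> dn; apply: (filtration_measurable walk); exact: (filtration_S walk). Qed.

(** E is the decreasing limit of the events D n of the past, and P(E) <= c P(D n). *)
Lemma good_null (G : nat -> 'rV[K]_d -> bool) :
  (forall n s, G n s -> \sum_i s 0 i = n%:R) ->
  (forall e, 0 < e -> exists N, forall n s, (N <= n)%N -> G n s ->
     `|n%:R^-1 *: s - p| <= e) ->
  let E := [set x | forall k, (d <= k)%N -> G k (S k x)] in
  measurable E /\ P E = 0%E.
Proof.
move=> G_sum G_cvg E.
pose D n := [set x | forall k, (d <= k)%N -> (k <= n)%N -> G k (S k x)].
have FD n : (d <= n)%N -> filt n (D n).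
  elim: n => [|n IH]; first by rewrite leqNgt d_gt0.
  rewrite leq_eqVlt => /orP[/eqP dn|dn].
    have -> : D n.+1 = [set x | G n.+1 (S n.+1 x)].
      apply/seteqP; split => x /=; first by apply; rewrite ?dn.
      move=> Gx k dk kn; suff -> : k = n.+1 by [].
      by apply/eqP; rewrite eqn_leq kn -dn.
    by apply: (filtration_S walk (fun s => G n.+1 s)); rewrite dn.
  have -> : D n.+1 = D n `&` [set x | G n.+1 (S n.+1 x)].
    apply/seteqP; split => x /=.
      move=> Dx; split; last by apply: Dx => //; exact: leqW.
      by move=> k dk kn; apply: Dx => //; exact: leqW.
    move=> [Dx Gx] k dk; rewrite leq_eqVlt => /orP[/eqP -> //|kn]; exact: Dx.
  apply: filtration_setI; last by apply: (filtration_S walk (fun s => G n.+1 s)); exact: leqW.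
  by apply: (filtration_mono (leqnSn n)); exact: IH.
have ED : E = \bigcap_n D (n + d)%N.
  apply/seteqP; split => x /=; first by move=> Ex n _ k dk _; exact: Ex.
  by move=> Dx k dk; apply: (Dx k I k dk); exact: leq_addr.
have mD n : measurable (D (n + d)%N).
  by apply: (filtration_measurable walk); apply: FD; exact: leq_addl.
have mE : measurable E by rewrite ED; exact: bigcapT_measurable.
split => //.
have [c c1 [n1 stay_le]] := stay_bound_all R_sym R_ge0 R_unit p_critical p_interior
  unstable G_sum G_cvg.
have le_c n : (n1 <= n)%N -> pr E <= c * pr (D (n + d)%N).
  move=> n1n; have dn : (d <= n + d)%N by exact: leq_addl.
  have -> : pr E = pr (D (n + d)%N `&` E).
    by congr pr; rewrite setIC; apply/esym/setIidPl; rewrite ED; exact: bigcap_inf.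
  apply: (pr_event_le walk dn mE) (FD _ dn) => B s y FB Bs.
  have [k kc] := stay_le (n + d)%N s y (leq_trans n1n (leq_addr _ _)).
  apply: (le_trans _ (ler_wpM2r (pr_ge0 _ _) kc)).
  rewrite -(pr_good walk G k dn FB Bs).
  have mB := filtration_measurable walk FB.
  apply: pr_le; [exact: measurableI|by apply: measurableI => //; exact: (good_measurable walk)|].
  apply: setIS => x Ex.
  have : forall m j, (d <= j)%N -> good S G m j x.
    elim=> [|m IH] j dj /=; first exact: Ex.
    by split; [exact: Ex|apply: IH; exact: leqW].
  by apply.
have prD : pr (D (n + d)%N) @[n --> \oo] --> pr E.
  apply: fine_cvg; rewrite -prE// [in X in _ --> X]ED.
  apply: nonincreasing_cvg_mu => //.
  - by rewrite -ge0_fin_numE// fin_num_measure.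
  - by rewrite -ED.
  - apply/nonincreasing_seqP => n; apply/subsetPset => x Dx k dk kn.
    by apply: Dx => //; rewrite addSn; exact: leqW.
have prE_le : pr E <= c * pr E.
  have cD : c * pr (D (n + d)%N) @[n --> \oo] --> c * pr E.
    by apply: cvgM => //; exact: cvg_cst.
  by apply: (cvgr_to_ge cD); exists n1 => // n /= /le_c.
rewrite prE//; congr (_%:E); apply/eqP; rewrite eq_le pr_ge0 andbT.
rewrite leNgt; apply/negP => E_gt0.
by move: prE_le; rewrite -subr_ge0 -{2}[pr E]mul1r -mulrBl pmulr_lge0// subr_ge0 leNgt c1.
Qed.

Local Notation A := [set x | occupation S n x @[n --> \oo] --> p].
Local Notation dist := (fun n x => `|occupation S n x - p|).

Lemma convergence_measurable : measurable A.
Proof.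
have -> : A = \bigcap_j \bigcup_N \bigcap_n [set x | (N <= n)%N -> (d <= n)%N ->
    dist n x <= j.+1%:R^-1].
  apply/seteqP; split => x /=.
    move=> /cvgrPdist_le xp j _; have j0 : 0 < j.+1%:R^-1 :> K by rewrite invr_gt0.
    have [N _ NP] := xp _ j0; exists N => // n _ Nn dn.
    by rewrite distrC; exact: NP.
  move=> H; apply/cvgrPdist_le => e e0.
  have [j _ jP] := near_infty_natSinv_lt (PosNum e0).
  have [N _ NP] := H j I.
  exists (maxn N d) => // n /=; rewrite geq_max => /andP[Nn dn].
  by rewrite distrC (le_trans (NP n I Nn dn))// ltW//; exact: (jP j (leqnn j)).
apply: bigcapT_measurable => j; apply: bigcupT_measurable => N.
apply: bigcapT_measurable => n.
have [dn|nd] := boolP (d <= n)%N.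
  pose Q s := (N <= n)%N -> `|n%:R^-1 *: s - p| <= j.+1%:R^-1.
  rewrite (_ : [set x | _] = [set x | Q (S n x)]); first exact: (measurable_S Q dn).
  apply/seteqP; split => x /= H Nn; first exact: (H Nn isT).
  by move=> _; exact: (H Nn).
by rewrite (_ : [set x | _] = setT)//; apply/seteqP; split => x.
Qed.

(** G allows the counts that occur somewhere on the set A \ B of uniform convergence
    given by Egorov's theorem. *)
Lemma nonconvergence : P A = 0%E.
Proof.
have mA := convergence_measurable.
apply: contrapT => PA0.
have A_gt0 : (0 < P A)%E by rewrite lt0e measure_ge0 andbT; exact/eqP.
have prA_gt0 : 0 < pr A by rewrite -lte_fin -prE.
(* the counts are those of the walk from time d on only, hence the shift *)
pose f n x := dist (n + d)%N x.
have mf n : measurable_fun A (f n).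
  move=> _ B mB; apply: measurableI => //.
  apply: (@measurable_S (fun s => B `|(n + d)%:R^-1 *: s - p|)); exact: leq_addl.
have fA x : A x -> f ^~ x @ \oo --> cst (0 : K) x.
  move=> Ax; rewrite /f.
  rewrite (cvg_shiftn d (fun n => dist n x)) /=.
  have L : occupation S n x - p @[n --> \oo] --> p - p.
    by apply: (@cvgB _ _ _ \oo); [exact: Ax|exact: cvg_cst].
  have L2 : `|occupation S n x - p| @[n --> \oo] --> `|p - p| by exact: cvg_norm L.
  rewrite subrr normr0 in L2. exact: L2.
have finA : (P A < +oo)%E by rewrite -ge0_fin_numE// fin_num_measure.
have [B [mB PB unif]] := measurable_realfun.pointwise_almost_uniform mf mA finA fA prA_gt0.
have unifN e : 0 < e -> exists N, forall n x, (N <= n)%N -> (A `\` B) x -> f n x <= e.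
  move=> e0.
  have : nbhs (cst 0 : {uniform` A `\` B -> K})
      [set h | forall x, (A `\` B) x -> `|h x| <= e].
    apply/uniform_nbhs; exists [set ab | `|ab.1 - ab.2| < e]; split.
      rewrite -entourage_ballE; by exists e.
    move=> h /= hE x Ax; have := hE x Ax; rewrite sub0r normrN; exact: ltW.
  move=> /unif [N _ NP]; exists N => n x Nn ABx.
  by have := NP n Nn x ABx; rewrite ger0_norm /f.
pose G n s := (d <= n)%N && `[< exists x, (A `\` B) x /\ S n x = s >].
have G_sum n s : G n s -> \sum_i s 0 i = n%:R.
  by move=> /andP[dn /asboolP[x [_ <-]]]; exact: (walk_sum walk).
have G_cvg e : 0 < e -> exists N, forall n s, (N <= n)%N -> G n s ->
     `|n%:R^-1 *: s - p| <= e.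
  move=> /unifN[N NP]; exists (N + d)%N => n s Nn /andP[dn /asboolP[x [ABx <-]]].
  have := NP (n - d)%N x _ ABx; rewrite /f subnK//; apply.
  by rewrite -(leq_add2r d) subnK.
have [mE PE] := good_null G_sum G_cvg.
have : (P (A `\` B) <= 0)%E.
  rewrite -PE le_measure// ?inE//; first exact: measurableD.
  move=> x ABx k dk; rewrite /G dk /=; apply/asboolP; by exists x.
rewrite leNgt => /negP; apply.
have mAB : measurable (A `&` B) by exact: measurableI.
have : P A = (P (A `\` B) + P (A `&` B))%E by exact: measureDI.
have PAB : (P (A `&` B) < P A)%E.
  apply: (@le_lt_trans _ _ (P B)); last by rewrite (prE P mA).
  by rewrite le_measure// inE.
move=> E; rewrite lt0e measure_ge0 andbT; apply/eqP => H0.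
by move: PAB; rewrite [X in (_ < X)%E]E H0 add0e ltxx.
Qed.

End NonConvergence.

Theorem theorem1p2 (K : realType) (d : nat) (d_gt0 : (0 < d)%N)
    (R : 'M[K]_d) (p : 'rV[K]_d)
    (R_sym : R^T = R)
    (R_ge0 : forall i j, 0 <= R i j)
    (R_col_gt0 : forall j, 0 < \sum_i R i j)
    (R_nonsingular : R \in unitmx)
    (p_critical : critical R p)
    (p_interior : forall i, 0 < p 0 i) :
  [/\ forall (disp : measure_display) (T : measurableType disp)
        (P : probability T K) (Y : nat -> T -> 'I_d)
        (S : nat -> T -> 'rV[K]_d),
        is_VRRW P Y S R d_gt0 ->
        ~ is_simplex_max (Hfun R) p ->
        P [set x | occupation S n x @[n --> \oo] --> p] = 0%E,
      ~ is_simplex_max (Hfun R) p <-> (1 < num_pos_eigenvalues R)%N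
    & (1 < num_pos_eigenvalues R)%N <->
      exists2 a : K, 0 < a & tangent_eigenvalue (pi_derivative R p) a].
Proof.
split.
- move=> disp T P Y S walk /(not_simplex_maxP R_sym p_critical p_interior) unstable.
  exact: (nonconvergence walk R_sym R_ge0 R_nonsingular p_critical p_interior unstable).
- exact: not_simplex_max_eigenvalues.
- rewrite -(not_simplex_max_eigenvalues R_sym p_critical p_interior).
  rewrite (not_simplex_maxP R_sym p_critical p_interior).
  by rewrite (tangent_eigenvalueP R_sym p_critical p_interior).
Qed.
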